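(* Let $n\ge3$, $0<s\le s'\le n-2$ and $\epsilon>0$. Then there exists $\delta_0=\delta_0(\epsilon)>0$ such that the following holds for all $0<\delta<\delta_0$: for any $(\delta,s',s,\delta^{-\epsilon})$-configuration $\Omega$ (with cinematic constant $K$ and doubling constant $D$), $$|\mathcal{E}|_\delta\gtrsim\delta^{7\epsilon-s-s'},$$ where $\mathcal{E}=\bigcup_{f\in F}E(f)$ is the union associated with $\Omega$.
   Context: $|A|_\delta$ denotes the $\delta$-covering number of $A$. Cinematic family: let $U\subset\mathbb{R}^k$ and $l\ge k$. A set $F\subset C^2(U,\mathbb{R}^l)$ is a cinematic family of maps with cinematic constant $K$ and doubling constant $D$ if (1) $F$ is contained in a ball of diameter $K$ in the usual $C^2(U,\mathbb{R}^l)$ metric; (2) $F$ is a doubling metric space with doubling constant at most $D$; (3) for all $f,g\in F$, $$\inf_{(x,\xi)\in U\times S^{k-1}}\{|f(x)-g(x)|+|\nabla_\xi f(x)-\nabla_\xi g(x)|\}\ge K^{-1}\|f-g\|_{C^2(U)},$$ where $\nabla_\xi h=\nabla h\cdot\xi$. Here $U=[0,1]^{n-2}$, $k=n-2$, $l=n-1$. $(\delta,s,C)$-set: a bounded subset $A$ of a metric space $E$ is a $(\delta,s,C)$-set if $|A\cap B(x,r)|_\delta\le Cr^s|A|_\delta$ for all $x\in E$ and $r\ge\delta$. Configuration: let $\sigma,\tau\in(0,n-2]$, $C>0$, $\delta>0$. A $(\delta,\sigma,\tau,C)$-configuration is a set $\Omega\subset C^2([0,1]^{n-2},[0,1]^{n-1})\times\mathbb{R}^{2n-3}$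 such that $F:=\{f:(f,p)\in\Omega \text{ for some }p\}$ is a non-empty $\delta$-separated $(\delta,\tau,C)$-subset of $C^2([0,1]^{n-2},[0,1]^{n-1})$ that is a cinematic family with cinematic constant $K$ and doubling constant $D$, and such that for each $f\in F$ the set $E(f):=\{p:(f,p)\in\Omega\}$ has the form $E(f)=\{(x,f(x)):x\in X_f\}\subset[0,1]^{2n-3}$, where $X_f$ is a non-empty $(\delta,\sigma,C)$-subset of $[0,1]^{n-2}$. Additionally, there exists $M\ge1$ with $|X_f|_\delta=M\ge C^{-1}\delta^{-\sigma}$ for all $f\in F$. Thus in the claim the sets $X_f$ are $(\delta,s',\delta^{-\epsilon})$-sets and $F$ is a $(\delta,s,\delta^{-\epsilon})$-set. The implicit constant in $\gtrsim$ may depend on $n$, $K$ and $D$.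
   Formalization: The implicit constant may also depend on a bound L for the C² norms of the maps in F (L = K/2 if the ball is centred at 0); with an arbitrary centre and a constant depending only on n, K, D the claim fails, by translating a family by a rapidly oscillating map. *)

(* Defs.v *)
From HB Require Import structures.
From mathcomp Require Import all_boot all_order all_algebra.
From mathcomp Require Import all_classical all_reals all_analysis.
Set Implicit Arguments.
Unset Strict Implicit.
Unset Printing Implicit Defensive.
Import Order.TTheory GRing.Theory Num.Theory.
Import numFieldNormedType.Exports.
Local Open Scope classical_set_scope.
Local Open Scope ring_scope.

(* A metric space is given by a carrier [E : set T] and a distance
   [d : T -> T -> R]; balls are closed and their centres lie in [E]. *)
Section Covering.
Context {R : realType} {T : Type}.
Implicit Types (d : T -> T -> R) (E A : set T).

Definition mball d E (x : T) (r : R) : set T := [set y | E y /\ d x y <= r].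

Definition mbounded d A : Prop :=
  exists r : R, forall x y, A x -> A y -> d x y <= r.

Definition covered_by_balls d E (delta : R) A (N : nat) : Prop :=
  exists c : 'I_N -> T, (forall i, E (c i)) /\
    A `<=` \bigcup_(i in [set: 'I_N]) mball d E (c i) delta.

(* |A|_delta; it is +oo when no finite cover exists. *)
Definition covering_number d E (delta : R) A : \bar R :=
  ereal_inf [set (N%:R : R)%:E | N in [set N | covered_by_balls d E delta A N]].

Definition separated_set d (delta : R) A : Prop :=
  forall x y, A x -> A y -> x <> y -> delta <= d x y.

Definition doubling d E (D : R) : Prop :=
  forall x r, E x -> 0 < r ->
    (covering_number d E (r / 2) (mball d E x r) <= D%:E)%E.

Definition delta_s_set d E (delta s C : R) A : Prop :=
  [/\ A `<=` E, mbounded d A &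
   forall x r, E x -> delta <= r ->
     (covering_number d E delta (A `&` mball d E x r)
        <= (C * r `^ s)%:E * covering_number d E delta A)%E].

End Covering.

Section Euclidean.
Context {R : realType}.

(* The library norm on ['rV[R]_m] is the sup norm. *)
Definition euclid_norm (m : nat) (v : 'rV[R]_m) : R :=
  Num.sqrt (\sum_(i < m) v 0 i ^+ 2).

Definition euclid_dist (m : nat) (u v : 'rV[R]_m) : R := euclid_norm (u - v).

Definition unit_sphere (m : nat) : set 'rV[R]_m := [set xi | euclid_norm xi = 1].

Definition cube (m : nat) : set 'rV[R]_m :=
  [set x | forall i, 0 <= x 0 i <= 1].

End Euclidean.
Arguments unit_sphere {R} m.
Arguments cube {R} m.

Section CTwo.
Context {R : realType} {k l : nat}.
Implicit Types (U V : set 'rV[R]_k) (W : set 'rV[R]_l).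
Implicit Types f g h : 'rV[R]_k -> 'rV[R]_l.

Definition C1_open V h : Prop := forall x, V x ->
  differentiable h x /\ forall v, {for x, continuous ('D_v h)}.

(* C^2(U, W). An element is represented by a map on the whole of R^k which is
   C^2 on a neighbourhood of U; only its restriction to U is meaningful, so
   that [C2dist U] is a pseudo-distance on representatives (they are at
   distance 0 exactly when they agree on U). *)
Definition C2maps U W : set ('rV[R]_k -> 'rV[R]_l) :=
  [set h | (exists V, [/\ open V, U `<=` V, C1_open V h &
                          forall v, C1_open V ('D_v h)]) /\
           (forall x, U x -> W (h x))].

Definition C0norm U h : R := sup [set euclid_norm (h x) | x in U].

Definition partial (i : 'I_k) h : 'rV[R]_k -> 'rV[R]_l :=
  'D_(delta_mx 0 i) h.

(* The sum over multi-indices of order at most 2 of the sup norms. *)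
Definition C2norm U h : R :=
  C0norm U h
  + \sum_(i < k) C0norm U (partial i h)
  + \sum_(i < k) \sum_(j < k | (i <= j)%N) C0norm U (partial i (partial j h)).

Definition C2dist U f g : R := C2norm U (f \- g).

Definition cinematic U (K D : R) (F : set ('rV[R]_k -> 'rV[R]_l)) : Prop :=
  [/\ F `<=` C2maps U setT,
      exists f0, C2maps U setT f0 /\
        F `<=` mball (C2dist U) (C2maps U setT) f0 (K / 2),
      doubling (C2dist U) F D &
      forall f g, F f -> F g ->
        K^-1 * C2norm U (f \- g) <=
        inf [set euclid_norm (f x - g x) + euclid_norm ('D_xi f x - 'D_xi g x)
            | x in U & xi in unit_sphere k]].

End CTwo.

Section Configuration.
Context {R : realType} {k l : nat}.
Implicit Type Omega : set (('rV[R]_k -> 'rV[R]_l) * 'rV[R]_(k + l)).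

Definition config_family Omega : set ('rV[R]_k -> 'rV[R]_l) :=
  [set f | exists p, Omega (f, p)].

Definition fiber Omega f : set 'rV[R]_(k + l) := [set p | Omega (f, p)].

Definition config_union Omega : set 'rV[R]_(k + l) :=
  \bigcup_(f in config_family Omega) fiber Omega f.

Definition graph_over (X : set 'rV[R]_k) (f : 'rV[R]_k -> 'rV[R]_l) :
  set 'rV[R]_(k + l) := [set row_mx x (f x) | x in X].

End Configuration.

(* (delta, sigma, tau, C)-configurations with cinematic constant K and doubling
   constant D; R^(2n-3) is R^(n-2) x R^(n-1), a pair (x, y) being the row
   [row_mx x y]. *)
Definition configuration (R : realType) (n : nat)
    (K D delta sigma tau C : R)
    (Omega : set (('rV[R]_(n - 2) -> 'rV[R]_(n - 1))
                  * 'rV[R]_((n - 2) + (n - 1)))) : Prop :=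
  let U := cube (n - 2) in
  let C2UW := C2maps U (cube (n - 1)) in
  let F := config_family Omega in
  [/\ [/\ 0 < sigma <= (n - 2)%:R, 0 < tau <= (n - 2)%:R, 0 < C & 0 < delta],
      [/\ F !=set0, separated_set (C2dist U) delta F,
          delta_s_set (C2dist U) C2UW delta tau C F & cinematic U K D F] &
      exists M : R, [/\ 1 <= M, C^-1 * delta `^ (- sigma) <= M &
        forall f, F f -> exists X : set 'rV[R]_(n - 2),
          [/\ X !=set0, delta_s_set (@euclid_dist R _) U delta sigma C X,
              covering_number (@euclid_dist R _) U delta X = M%:E,
              fiber Omega f = graph_over X f &
              fiber Omega f `<=` cube _]]].

(* Main.v *)
(* An L^2 argument. Cut R^(2n-3) into cells of side delta / (2n-3), and let Q_f be
   the set of cells met by E(f). Then |Q_f| >= |X_f|_delta = M, and the union of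
   the Q_f has at most C |E|_delta elements, so by Cauchy-Schwarz
     (M |F|)^2 <= C |E|_delta sum_(f,g) |Q_f cap Q_g|.
   If f and g are at distance d >> delta, the cinematic condition and Taylor's
   formula give |h(x) - h(y)| >= c d |x - y| for h = f - g and nearby points x, y
   of {|h| <= C delta}; hence this set is covered by boundedly many balls of radius
   C delta / d, and |Q_f cap Q_g| <= C delta^-eps (delta / d)^s' M. By the
   doubling condition at most C delta^-eps (2^i delta)^s |F| of the g satisfy
   d <= 2^i delta. As s <= s', each of the O(log (1 / delta)) dyadic scales
   contributes at most C delta^(s - 2 eps) M |F| to the sum over g. *)
Require Import Defs.
From HB Require Import structures.
From mathcomp Require Import all_boot all_order all_algebra.
From mathcomp Require Import all_classical all_reals all_analysis.
From mathcomp Require Import ring lra zify.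
Import Order.TTheory GRing.Theory Num.Theory.
Import numFieldNormedType.Exports.
Local Open Scope classical_set_scope.
Local Open Scope ring_scope.

(** * Euclidean norm *)

(** The cinematic condition is infinitesimal, so it separates points of the near-zero set of h only
    locally. Its lower bound and the Taylor remainder are both proportional to the C^2 norm of h.
    The radius on which the linear part dominates therefore depends on K and the dimension alone,
    and the cube splits into a number of pieces that is the same for all pairs and all scales. The
    side of the cells is chosen so that a cell has Euclidean diameter at most delta: this is what
    turns a list of cells into a cover by delta-balls. Budget of exponents: one eps for each of the
    two non-concentration conditions, one for the lower bound on M, and two for the logarithm. The
    constant in front of the logarithm depends on K but goes into c, so the threshold for delta can
    depend on eps alone. *)

Lemma cauchy_schwarz_sum {R : realType} {I : finType} (a b : I -> R) :
  (\sum_i a i * b i) ^+ 2 <= (\sum_i a i ^+ 2) * (\sum_i b i ^+ 2).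
Proof.
(* Lagrange's identity: this sum of squares is twice the defect of the inequality. *)
have : 0 <= \sum_i \sum_j (a i * b j - a j * b i) ^+ 2.
  by apply: sumr_ge0 => i _; apply: sumr_ge0 => j _; exact: sqr_ge0.
have -> : \sum_i \sum_j (a i * b j - a j * b i) ^+ 2 =
    2 * ((\sum_i a i ^+ 2) * (\sum_i b i ^+ 2) - (\sum_i a i * b i) ^+ 2).
  transitivity (\sum_i \sum_j a i ^+ 2 * b j ^+ 2
    + \sum_i \sum_j b i ^+ 2 * a j ^+ 2
    - 2 * \sum_i \sum_j (a i * b i) * (a j * b j)).
    rewrite mulr_sumr -big_split -sumrB; apply: eq_bigr => i _ /=.
    by rewrite mulr_sumr -big_split -sumrB; apply: eq_bigr => j _ /=; ring.
  have sumM (u v : I -> R) : \sum_i \sum_j u i * v j = (\sum_i u i) * (\sum_i v i).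
    by rewrite mulr_suml; apply: eq_bigr => i _; rewrite mulr_sumr.
  by rewrite !sumM; ring.
by rewrite pmulr_rge0 // subr_ge0.
Qed.

Section EuclidNorm.
Context {R : realType} {m : nat}.
Implicit Types u v : 'rV[R]_m.

Lemma euclid_norm_ge0 v : 0 <= euclid_norm v.
Proof. exact: sqrtr_ge0. Qed.

Lemma sqr_euclid_norm v : euclid_norm v ^+ 2 = \sum_i v 0 i ^+ 2.
Proof. by rewrite sqr_sqrtr //; apply: sumr_ge0 => i _; exact: sqr_ge0. Qed.

Lemma normr_coord_le v i : `|v 0 i| <= euclid_norm v.
Proof.
rewrite -(@ler_pXn2r _ 2) ?nnegrE ?euclid_norm_ge0 //.
rewrite sqr_euclid_norm real_normK ?num_real // (bigD1 i) //= lerDl.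
by apply: sumr_ge0 => j _; exact: sqr_ge0.
Qed.

Lemma euclid_normN v : euclid_norm (- v) = euclid_norm v.
Proof.
by rewrite /euclid_norm; congr Num.sqrt; apply: eq_bigr => i _; rewrite mxE sqrrN.
Qed.

Lemma euclid_norm0 : euclid_norm (0 : 'rV[R]_m) = 0.
Proof.
by rewrite /euclid_norm big1 ?sqrtr0 // => i _; rewrite mxE expr0n.
Qed.

Lemma euclid_normZ a v : euclid_norm (a *: v) = `|a| * euclid_norm v.
Proof.
rewrite /euclid_norm -sqrtr_sqr -sqrtrM ?sqr_ge0 // mulr_sumr.
by congr Num.sqrt; apply: eq_bigr => i _; rewrite mxE exprMn.
Qed.

Lemma euclid_normD u v : euclid_norm (u + v) <= euclid_norm u + euclid_norm v.
Proof.
rewrite -(@ler_pXn2r _ 2) ?nnegrE ?addr_ge0 ?euclid_norm_ge0 //.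
rewrite sqrrD !sqr_euclid_norm.
have -> : \sum_i (u + v) 0 i ^+ 2 =
    \sum_i u 0 i ^+ 2 + (\sum_i u 0 i * v 0 i) *+ 2 + \sum_i v 0 i ^+ 2.
  by rewrite -sumrMnl -!big_split; apply: eq_bigr => i _ /=; rewrite mxE sqrrD.
rewrite lerD2r lerD2l lerMn2r //=.
apply: le_trans (ler_norm _) _.
rewrite -(@ler_pXn2r _ 2) ?nnegrE ?mulr_ge0 ?euclid_norm_ge0 //.
rewrite exprMn !sqr_euclid_norm real_normK ?num_real //.
exact: cauchy_schwarz_sum.
Qed.

Lemma euclid_norm_le_sum v : euclid_norm v <= \sum_i `|v 0 i|.
Proof.
have ge0 : 0 <= \sum_i `|v 0 i| by apply: sumr_ge0.
rewrite -(@ler_pXn2r _ 2) ?nnegrE ?euclid_norm_ge0 // sqr_euclid_norm.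
rewrite expr2 mulr_suml; apply: ler_sum => i _.
rewrite -real_normK ?num_real // expr2 ler_wpM2l //.
by rewrite (bigD1 i) //= lerDl; apply: sumr_ge0.
Qed.

Lemma euclid_norm_le_max v (b : R) :
  (forall i, `|v 0 i| <= b) -> euclid_norm v <= m%:R * b.
Proof.
move=> vb; apply: (le_trans (euclid_norm_le_sum v)).
rewrite mulr_natl -[in leRHS](card_ord m) -sumr_const.
by apply: ler_sum.
Qed.

End EuclidNorm.

(** * C^2 maps on the cube *)

Section C2On.
Context {R : realType} {k l : nat}.
Implicit Types (U V : set 'rV[R]_k) (f g h : 'rV[R]_k -> 'rV[R]_l).

Lemma near_open {V} (P : 'rV[R]_k -> Prop) : open V -> (forall x, V x -> P x) ->
  forall x, V x -> \forall y \near x, P y.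
Proof.
by move=> oV VP x Vx; apply: filterS (open_nbhs_nbhs (conj oV Vx)) => y; exact: VP.
Qed.

(* What the argument uses of [C2maps]; unlike [C1_open], it only involves
   notions for which locality is available in the library. *)
Definition C2on U h : Prop := exists V, [/\ open V, U `<=` V,
  forall x, V x -> differentiable h x,
  forall i x, V x -> {for x, continuous (partial i h)} &
  forall i j x, V x -> derivable (partial j h) x (delta_mx 0 i) /\
    {for x, continuous (partial i (partial j h))}].

Lemma C2on_C2maps {U W h} : C2maps U W h -> C2on U h.
Proof.
move=> [[V [oV UV hV DhV]] _]; exists V; split.
- exact: oV.
- exact: UV.
- by move=> x Vx; have [dh _] := hV x Vx; exact: dh.
- by move=> i x Vx; have [_ ch] := hV x Vx; exact: ch.
- move=> i j x Vx; have [dD cD] := DhV (delta_mx 0 j) x Vx.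
  by split; [exact: diff_derivable|exact: cD].
Qed.

Lemma C2onP {U h} : C2on U h -> forall x, U x ->
  [/\ differentiable h x, forall i, {for x, continuous (partial i h)},
      forall i j, derivable (partial j h) x (delta_mx 0 i) &
      forall i j, {for x, continuous (partial i (partial j h))}].
Proof.
move=> [V [_ UV dh ch cch]] x Ux; have Vx := UV x Ux; split.
- exact: dh.
- by move=> i; exact: ch.
- by move=> i j; have [dd _] := cch i j x Vx; exact: dd.
- by move=> i j; have [_ cc] := cch i j x Vx; exact: cc.
Qed.

Lemma partialB {f g x} i : differentiable f x -> differentiable g x ->
  partial i (f \- g) x = partial i f x - partial i g x.
Proof. by move=> df dg; apply: deriveB; exact: diff_derivable. Qed.

(** Differentiating twice requires the first-order identity on a neighbourhood of the point.
    Everything is therefore proved on the open set [V]&[V'] and only then restricted to U. *)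
Lemma C2onB_common {U f g} : C2on U f -> C2on U g ->
  C2on U (f \- g) /\ forall i j x, U x ->
    partial i (partial j (f \- g)) x =
    partial i (partial j f) x - partial i (partial j g) x.
Proof.
move=> [V [oV UV df cf ccf]] [V' [oV' UV' dg cg ccg]].
pose W := V `&` V'; have oW : open W by exact: openI.
have pB i x : W x -> partial i (f \- g) x = (partial i f \- partial i g) x.
  by move=> [Vx V'x]; apply: partialB; [exact: df|exact: dg].
have npB i x : W x -> \forall y \near x, (partial i f \- partial i g) y = partial i (f \- g) y.
  by move=> Wx; apply: (near_open _ oW _ x Wx) => y Wy; rewrite pB.
have ppB i j x : W x -> partial i (partial j (f \- g)) x =
    (partial i (partial j f) \- partial i (partial j g)) x.
  move=> Wx; have [Vx V'x] := Wx.
  rewrite /partial -(near_eq_derive _ (npB j x Wx)) /= deriveB //.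
    by have [] := ccf i j x Vx.
  by have [] := ccg i j x V'x.
have contB (u v w : 'rV[R]_k -> 'rV[R]_l) x : W x -> (forall y, W y -> w y = (u \- v) y) ->
    {for x, continuous u} -> {for x, continuous v} -> {for x, continuous w}.
  move=> Wx wuv cu cv; rewrite /prop_for /continuous_at wuv //.
  apply: cvg_trans (cvgB cu cv); apply: (@near_eq_cvg _ _ (nbhs x)).
  by apply: filterS (open_nbhs_nbhs (conj oW Wx)) => y Wy; rewrite wuv.
split; last by move=> i j x Ux; apply: ppB; split; [exact: UV|exact: UV'].
exists W; split; first exact: oW.
- by move=> x Ux; split; [exact: UV|exact: UV'].
- by move=> x [Vx V'x]; apply: differentiableB; [exact: df|exact: dg].
- move=> i x Wx; have [Vx V'x] := Wx.
  exact: contB Wx (pB i) (cf i x Vx) (cg i x V'x).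
- move=> i j x Wx; have [Vx V'x] := Wx.
  have [dfx cfx] := ccf i j x Vx; have [dgx cgx] := ccg i j x V'x.
  split; first exact: near_eq_derivable (npB j x Wx) (derivableB dfx dgx).
  exact: contB Wx (ppB i j) cfx cgx.
Qed.

Lemma C2onB {U f g} : C2on U f -> C2on U g -> C2on U (f \- g).
Proof. by move=> Uf Ug; have [] := C2onB_common Uf Ug. Qed.

Lemma partial2B {U f g} i j x : C2on U f -> C2on U g -> U x ->
  partial i (partial j (f \- g)) x =
  partial i (partial j f) x - partial i (partial j g) x.
Proof. by move=> Uf Ug; have [_] := C2onB_common Uf Ug; exact. Qed.

Lemma compact_cube : compact (cube k : set 'rV[R]_k).
Proof.
have -> : cube k = [set v : 'rV[R]_k | forall i, `[0, 1]%classic (v ord0 i)].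
  by apply/seteqP; split => v /= + i => /(_ i); rewrite in_itv.
have := @rV_compact R k (fun=> `[0, 1]%classic) (fun=> @segment_compact R 0 1).
exact.
Qed.

Lemma cube_nonempty : (cube k : set 'rV[R]_k) !=set0.
Proof. by exists 0 => i /=; rewrite mxE lexx ler01. Qed.

(** [sup] is a default value on unbounded sets, so every estimate by [C0norm] rests on this;
    compactness of the cube gives it. *)
Lemma C0norm_ubound h : (forall x, cube k x -> {for x, continuous h}) ->
  has_ubound [set euclid_norm (h x) | x in cube k].
Proof.
move=> ch; have : compact (h @` cube k).
  apply: (continuous_compact _ compact_cube).
  apply: continuous_in_subspaceT => x Ux.
  exact: ch (set_mem Ux).
move=> /compact_bounded[M [_ /(_ (M + 1))]]; rewrite ltrDl ltr01 => /(_ isT) Mh.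
exists (l%:R * (M + 1)) => _ [x Ux <-]; apply: euclid_norm_le_max => i.
apply: le_trans (Mh (h x) _); last by exists x.
rewrite [leRHS]/Num.norm /= mx_normrE.
exact: (le_bigmax _ (fun ij : 'I_1 * 'I_l => `|h x ij.1 ij.2|) (0, i)).
Qed.

Lemma le_C0norm {h x} : (forall x, cube k x -> {for x, continuous h}) ->
  cube k x -> euclid_norm (h x) <= C0norm (cube k) h.
Proof.
move=> /C0norm_ubound ub Ux; apply: (ub_le_sup ub).
by exists x.
Qed.

Lemma C0norm_le h b : (forall x, cube k x -> euclid_norm (h x) <= b) ->
  C0norm (cube k) h <= b.
Proof.
move=> hb; apply: ge_sup; last by move=> _ [x Ux <-]; exact: hb.
by have [x Ux] := cube_nonempty; exists (euclid_norm (h x)), x.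
Qed.

Lemma eq_C0norm {h g} : (forall x, cube k x -> euclid_norm (h x) = euclid_norm (g x)) ->
  C0norm (cube k) h = C0norm (cube k) g.
Proof.
move=> hg; congr sup; apply/seteqP.
by split => _ [x Ux <-]; exists x => //; rewrite hg.
Qed.

Lemma C0norm_ge0 h : (forall x, cube k x -> {for x, continuous h}) ->
  0 <= C0norm (cube k) h.
Proof.
move=> ch; have [x Ux] := cube_nonempty.
exact: le_trans (euclid_norm_ge0 _) (le_C0norm ch Ux).
Qed.

Section OneMap.
Context {h} (hC2 : C2on (cube k) h).

Lemma C2on_continuous x : cube k x -> {for x, continuous h}.
Proof.
move=> Ux; have [dh _ _ _] := C2onP hC2 x Ux; exact: differentiable_continuous dh.
Qed.

Lemma C2on_continuous1 i x : cube k x -> {for x, continuous (partial i h)}.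
Proof. by move=> Ux; have [_ ch _ _] := C2onP hC2 x Ux; exact: ch. Qed.

Lemma C2on_continuous2 i j x : cube k x ->
  {for x, continuous (partial i (partial j h))}.
Proof. by move=> Ux; have [_ _ _ ch] := C2onP hC2 x Ux; exact: ch. Qed.

Let n0 := C0norm_ge0 _ C2on_continuous.
Let n1 := fun i => C0norm_ge0 _ (C2on_continuous1 i).
Let n2 := fun i j => C0norm_ge0 _ (C2on_continuous2 i j).

Let s1 : 0 <= \sum_(i < k) C0norm (cube k) (partial i h).
Proof. by apply: sumr_ge0 => i _; exact: n1. Qed.

Let s2 : 0 <= \sum_(i < k) \sum_(j < k | (i <= j)%N)
  C0norm (cube k) (partial i (partial j h)).
Proof. by apply: sumr_ge0 => i _; apply: sumr_ge0 => j _; exact: n2. Qed.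

Lemma C2norm_ge0 : 0 <= C2norm (cube k) h.
Proof. by rewrite /C2norm; apply: addr_ge0 => //; apply: addr_ge0. Qed.

Lemma sum_partial_le_C2norm :
  \sum_(i < k) C0norm (cube k) (partial i h) <= C2norm (cube k) h.
Proof. by rewrite /C2norm addrAC lerDr; apply: addr_ge0. Qed.

Lemma sum_partial2_le_C2norm :
  \sum_(i < k) \sum_(j < k | (i <= j)%N) C0norm (cube k) (partial i (partial j h))
  <= C2norm (cube k) h.
Proof. by rewrite /C2norm lerDr; apply: addr_ge0. Qed.
End OneMap.

(* Equations between partial derivatives of different maps are applied as terms
   in what follows, because matching such maps by rewriting unfolds the limits. *)
Let euclid_norm_opp (a b c d : 'rV[R]_l) :
  a = c - d -> b = d - c -> euclid_norm a = euclid_norm b.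
Proof. by move=> -> ->; rewrite -euclid_normN opprB. Qed.

Let chasles (a b c u v w : 'rV[R]_l) :
  a = u - v -> b = u - w -> c = w - v -> a = b + c.
Proof. by move=> -> -> ->; rewrite addrA subrK. Qed.

Lemma C2dist_triangle {f g h} :
  C2on (cube k) f -> C2on (cube k) g -> C2on (cube k) h ->
  C2dist (cube k) f g <= C2dist (cube k) f h + C2dist (cube k) h g.
Proof.
move=> Uf Ug Uh; rewrite /C2dist /C2norm.
have C0D (u v w : 'rV[R]_k -> 'rV[R]_l) :
    (forall x, cube k x -> {for x, continuous u}) ->
    (forall x, cube k x -> {for x, continuous v}) ->
    (forall x, cube k x -> w x = u x + v x) ->
    C0norm (cube k) w <= C0norm (cube k) u + C0norm (cube k) v.
  move=> cu cv wuv; apply: C0norm_le => x Ux; rewrite (wuv x Ux).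
  apply: le_trans (euclid_normD _ _) _.
  exact: lerD (le_C0norm cu Ux) (le_C0norm cv Ux).
have Ufh := C2onB Uf Uh; have Uhg := C2onB Uh Ug.
rewrite addrACA [X in _ <= X + _]addrACA -!big_split /=.
apply: lerD; first apply: lerD.
- apply: C0D; [exact: C2on_continuous|exact: C2on_continuous|].
  by move=> x _ /=; rewrite addrA subrK.
- apply: ler_sum => i _; apply: C0D; [exact: C2on_continuous1|exact: C2on_continuous1|].
  move=> x Ux; have [df _ _ _] := C2onP Uf x Ux; have [dg _ _ _] := C2onP Ug x Ux.
  have [dh _ _ _] := C2onP Uh x Ux.
  exact: chasles (partialB i df dg) (partialB i df dh) (partialB i dh dg).
apply: ler_sum => i _; rewrite -big_split; apply: ler_sum => j _ /=.
apply: C0D; [exact: C2on_continuous2|exact: C2on_continuous2|] => x Ux.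
exact: chasles (partial2B i j x Uf Ug Ux) (partial2B i j x Uf Uh Ux)
  (partial2B i j x Uh Ug Ux).
Qed.

Lemma C2distC {f g} : C2on (cube k) f -> C2on (cube k) g ->
  C2dist (cube k) f g = C2dist (cube k) g f.
Proof.
move=> Uf Ug; rewrite /C2dist /C2norm.
apply: (f_equal2 +%R); first apply: (f_equal2 +%R).
- by apply: eq_C0norm => x _; exact: euclid_norm_opp.
- apply: eq_bigr => i _; apply: eq_C0norm => x Ux.
  have [df _ _ _] := C2onP Uf x Ux; have [dg _ _ _] := C2onP Ug x Ux.
  exact: euclid_norm_opp (partialB i df dg) (partialB i dg df).
apply: eq_bigr => i _; apply: eq_bigr => j _; apply: eq_C0norm => x Ux.
exact: euclid_norm_opp (partial2B i j x Uf Ug Ux) (partial2B i j x Ug Uf Ux).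
Qed.

Lemma C2distxx {f} : C2on (cube k) f -> C2dist (cube k) f f = 0.
Proof.
move=> Uf; have C00 h : (forall x, cube k x -> h x = 0) -> C0norm (cube k) h = 0.
  move=> h0; rewrite /C0norm (_ : [set _ | x in _] = [set 0]) ?sup1 //.
  apply/seteqP; split => [_ [x Ux <-]|_ ->] /=; first by rewrite h0 // euclid_norm0.
  by have [x Ux] := cube_nonempty; exists x => //; rewrite h0 // euclid_norm0.
have z0 : C0norm (cube k) (f \- f) = 0 by apply: C00 => x _; exact: subrr.
have z1 : \sum_(i < k) C0norm (cube k) (partial i (f \- f)) = 0.
  apply: big1 => i _; apply: C00 => x Ux; have [df _ _ _] := C2onP Uf x Ux.
  exact: etrans (partialB i df df) (subrr _).
have z2 : \sum_(i < k) \sum_(j < k | (i <= j)%N)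
    C0norm (cube k) (partial i (partial j (f \- f))) = 0.
  apply: big1 => i _; apply: big1 => j _; apply: C00 => x Ux.
  exact: etrans (partial2B i j x Uf Uf Ux) (subrr _).
apply: etrans (f_equal2 +%R (f_equal2 +%R z0 z1) z2) _.
by rewrite !addr0.
Qed.
End C2On.

(** * Taylor expansion *)

Section Taylor.
Context {R : realType} {k l : nat}.
Implicit Types (x y z : 'rV[R]_k) (h : 'rV[R]_k -> 'rV[R]_l).

Lemma is_derive_line h x (v : 'rV[R]_k) (a : 'I_l) (r : R) :
  derivable h (x + r *: v) v ->
  is_derive r 1 (fun s => h (x + s *: v) 0 a) ('D_v h (x + r *: v) 0 a).
Proof.
move=> dh; have dha := (derivable_mxP _ _ _).1 dh 0 a.
have E : (fun s : R => s^-1 *: (((fun s' => h (x + s' *: v) 0 a) \o shift r) (s *: 1)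
      - h (x + r *: v) 0 a)) =
    (fun s : R => s^-1 *: (((fun y => h y 0 a) \o shift (x + r *: v)) (s *: v)
      - h (x + r *: v) 0 a)).
  apply/funext => s /=; congr (_ *: (h _ 0 a - _)).
  by rewrite -[s *: 1]/(s * 1) mulr1 scalerDl addrCA.
apply: DeriveDef; first by rewrite /derivable /= E.
apply: etrans (_ : 'D_v (fun y => h y 0 a) (x + r *: v) = _); last first.
  by rewrite derive_mx // mxE.
exact: (congr1 (fun q : R -> R => lim (q @ 0^')) E).
Qed.

Lemma coord_mvt h x i (t : R) (a : 'I_l) :
  (forall th : R, 0 <= th <= 1 -> derivable h (x + (th * t) *: delta_mx 0 i) (delta_mx 0 i)) ->
  exists2 th : R, 0 <= th <= 1 &
    h (x + t *: delta_mx 0 i) 0 a - h x 0 a =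
    t * partial i h (x + (th * t) *: delta_mx 0 i) 0 a.
Proof.
set e := delta_mx 0 i => dh.
have [->|t0] := eqVneq t 0.
  by exists 0; rewrite ?lexx ?ler01 // scale0r addr0 subrr mul0r.
pose phi (s : R) := h (x + s *: e) 0 a.
pose dphi (s : R) := partial i h (x + s *: e) 0 a.
(* [0 <= s / t <= 1] says that s lies between 0 and t whatever the sign of t, so both orders of the
   endpoints are treated alike. *)
have dphiP s : 0 <= s / t <= 1 -> is_derive s 1 phi (dphi s).
  by move=> /dh; rewrite divfK //; exact: is_derive_line.
have mvt (u v : R) : u <= v -> (forall s, s \in `[u, v] -> 0 <= s / t <= 1) ->
    exists2 c, 0 <= c / t <= 1 & phi v - phi u = dphi c * (v - u).
  move=> uv st; have [||c cuv E] := @MVT_segment _ phi dphi _ _ uv.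
  - by move=> s suv; apply/dphiP/st; exact: subset_itv_oo_cc suv.
  - apply: derivable_within_continuous => s suv.
    by have [] := dphiP s (st s suv).
  by exists c => //; exact: st.
have phi0 : phi 0 = h x 0 a by rewrite /phi scale0r addr0.
rewrite -/(phi t) -phi0.
have [tp|tn] := ltrP 0 t.
  have [|s|c c01 E] := mvt 0 t; first exact: ltW.
    rewrite in_itv /= => /andP[s0 st].
    by rewrite divr_ge0 ?(ltW tp) //= ler_pdivrMr // mul1r.
  exists (c / t) => //; rewrite divfK // E subr0 mulrC //.
have {tn} tn : t < 0 by rewrite lt_neqAle t0.
have [|s|c c01 E] := mvt t 0; first exact: ltW.
  rewrite in_itv /= => /andP[ts s0].
  by rewrite mulr_le0 ?invr_le0 ?(ltW tn) //= ler_ndivrMr // mul1r.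
exists (c / t) => //; rewrite divfK // -[LHS]opprB E sub0r mulrN opprK mulrC //.
Qed.

(* The path from [x] to [y] changes the coordinates in increasing order, so that
   [C2on_taylor] meets only the derivatives [partial j (partial i h)] with
   [j <= i], which are those bounded by [C2norm]. *)
Lemma hybrid_mvt h x y (a : 'I_l) : cube k x -> cube k y ->
  (forall i z, cube k z -> derivable h z (delta_mx 0 i)) ->
  exists p : 'I_k -> 'rV[R]_k,
    (forall i, [/\ cube k (p i),
      forall j, `|p i 0 j - x 0 j| <= `|y 0 j - x 0 j| &
      forall j : 'I_k, (i < j)%N -> p i 0 j = x 0 j]) /\
    h y 0 a - h x 0 a = \sum_i (y 0 i - x 0 i) * partial i h (p i) 0 a.
Proof.
move=> Ux Uy dh.
pose z (m : nat) : 'rV[R]_k := \row_j if (j < m)%N then y 0 j else x 0 j.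
pose e (i : 'I_k) : 'rV[R]_k := delta_mx 0 i.
pose q (i : 'I_k) th := z i + (th * (y 0 i - x 0 i)) *: e i.
have qE i th j : q i th 0 j =
    if (j < i)%N then y 0 j else if j == i then x 0 i + th * (y 0 i - x 0 i) else x 0 j.
  rewrite !mxE /=; have [->|ji] := eqVneq j i.
    by rewrite ltnn mulr1.
  by rewrite mulr0 addr0.
have Uq (i : 'I_k) (th : R) : 0 <= th <= 1 -> cube k (q i th).
  move=> /andP[th0 th1] j; rewrite qE; case: ifP => _; first exact: Uy.
  case: ifP => _; last exact: Ux.
  have /andP[x0 x1] := Ux i; have /andP[y0 y1] := Uy i.
  by apply/andP; split; nra.
have dq (i : 'I_k) (th : R) : 0 <= th <= 1 ->
    derivable h (z i + (th * (y 0 i - x 0 i)) *: delta_mx 0 i) (delta_mx 0 i).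
  by move=> th01; exact: dh i (q i th) (Uq i th th01).
have /choice[th thP] (i : 'I_k) : exists th : R, 0 <= th <= 1 /\
    h (z i + (y 0 i - x 0 i) *: e i) 0 a - h (z i) 0 a =
    (y 0 i - x 0 i) * partial i h (q i th) 0 a.
  by have [th th01 E] := coord_mvt h (z i) i _ a (dq i); exists th.
exists (fun i => q i (th i)); split=> [i|].
  have [th01 _] := thP i; split; first exact: Uq.
    move=> j; rewrite qE; case: ifP => // _; case: ifP => [/eqP ->|_]; last by rewrite subrr normr0.
    rewrite addrC addKr normrM; apply: ler_piMl => //.
    by case/andP: th01 => th0 th1; rewrite ger0_norm.
  move=> j ij; rewrite qE ltnNge (ltnW ij) /=.
  by case: eqP => // ji; rewrite ji ltnn in ij.
have zS (i : 'I_k) : z i.+1 = z i + (y 0 i - x 0 i) *: e i.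
  apply/rowP => j; rewrite !mxE /= ltnS leq_eqVlt -val_eqE.
  have [/val_inj ->|ji] := eqVneq (j : nat) i; last by rewrite /= mulr0 addr0.
  by rewrite /= ltnn mulr1 addrC subrK.
have zk : z k = y by apply/rowP => j; rewrite mxE ltn_ord.
have z0 : z 0%N = x by apply/rowP => j; rewrite mxE.
rewrite -zk -[in LHS]z0 -(@telescope_sumr _ 0 k (fun m => h (z m) 0 a)) // big_mkord.
by rewrite zk; apply: eq_bigr => i _; rewrite zS; case: (thP i).
Qed.

Lemma C2on_lipschitz h x y (a : 'I_l) (b : R) : C2on (cube k) h ->
  cube k x -> cube k y -> 0 <= b -> (forall i, `|y 0 i - x 0 i| <= b) ->
  `|h y 0 a - h x 0 a| <= b * C2norm (cube k) h.
Proof.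
move=> hC2 Ux Uy b0 yxb.
have dh i z : cube k z -> derivable h z (delta_mx 0 i).
  by move=> Uz; have [dz _ _ _] := C2onP hC2 z Uz; exact: diff_derivable dz.
have [p [pP ->]] := hybrid_mvt h x y a Ux Uy dh.
apply: le_trans (ler_norm_sum _ _ _) _.
apply: le_trans (_ : \sum_i b * C0norm (cube k) (partial i h) <= _); last first.
  by rewrite -mulr_sumr; apply: ler_wpM2l => //; exact: sum_partial_le_C2norm.
apply: ler_sum => i _; rewrite normrM; apply: ler_pM => //.
have [Up _ _] := pP i; apply: le_trans (normr_coord_le _ _) _.
exact: le_C0norm (C2on_continuous1 hC2 i) Up.
Qed.

Lemma C2on_taylor h x y (a : 'I_l) (b : R) : C2on (cube k) h ->
  cube k x -> cube k y -> 0 <= b -> (forall i, `|y 0 i - x 0 i| <= b) ->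
  `|h y 0 a - h x 0 a - \sum_i (y 0 i - x 0 i) * partial i h x 0 a|
    <= b ^+ 2 * C2norm (cube k) h.
Proof.
move=> hC2 Ux Uy b0 yxb.
have dh i z : cube k z -> derivable h z (delta_mx 0 i).
  by move=> Uz; have [dz _ _ _] := C2onP hC2 z Uz; exact: diff_derivable dz.
have dph i j z : cube k z -> derivable (partial i h) z (delta_mx 0 j).
  by move=> Uz; have [_ _ dz _] := C2onP hC2 z Uz; exact: dz.
have [p [pP ->]] := hybrid_mvt h x y a Ux Uy dh.
rewrite -sumrB; apply: le_trans (ler_norm_sum _ _ _) _.
pose c (i j : 'I_k) := C0norm (cube k) (partial j (partial i h)).
apply: (@le_trans _ _ (\sum_(i < k) \sum_(j < k | (j <= i)%N) b ^+ 2 * c i j)); last first.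
  (* In [C2norm] the outer derivative carries the smaller index; exchanging the sums brings the
     double sum to that form. *)
  rewrite (exchange_big_dep predT) //=.
  under eq_bigr do rewrite -mulr_sumr.
  rewrite -mulr_sumr; apply: ler_wpM2l; first exact: sqr_ge0.
  exact: sum_partial2_le_C2norm.
apply: ler_sum => i _; have [Up pb p0] := pP i.
rewrite -mulrBr normrM expr2.
under eq_bigr do rewrite -mulrA.
rewrite -mulr_sumr; apply: ler_pM => //.
(* Second use of the path, now from x to the intermediate point [p i]; the coordinates where these
   agree contribute nothing. *)
have [q [qP ->]] := hybrid_mvt (partial i h) x (p i) a Ux Up (dph i).
apply: le_trans (ler_norm_sum _ _ _) _.
rewrite (bigID (fun j : 'I_k => (j <= i)%N)) /= [X in _ + X]big1 ?addr0; last first.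
  by move=> j; rewrite -ltnNge => /p0 ->; rewrite subrr mul0r normr0.
apply: ler_sum => j _; rewrite normrM; apply: ler_pM => //.
  exact: le_trans (pb j) (yxb j).
have [Uq _ _] := qP j; apply: le_trans (normr_coord_le _ _) _.
exact: le_C0norm (C2on_continuous2 hC2 j i) Uq.
Qed.

Lemma derive_partial h x (v : 'rV[R]_k) : differentiable h x ->
  'D_v h x = \sum_i v 0 i *: partial i h x.
Proof.
move=> dh; rewrite (deriveE _ dh) [in LHS](row_sum_delta v) linear_sum.
by apply: eq_bigr => i _; rewrite linearZ /= /partial (deriveE _ dh).
Qed.

(** In the direction from x to y the derivative at x has size at least [kappa - euclid_norm (h x)];
    multiplied by the distance, it equals h(y) - h(x) up to the Taylor remainder. The factor l comes
    from estimating that remainder coordinate by coordinate. *)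
Lemma transversal_dist h x y (kappa : R) : C2on (cube k) h ->
  cube k x -> cube k y ->
  (forall xi, unit_sphere k xi -> kappa <= euclid_norm (h x) + euclid_norm ('D_xi h x)) ->
  euclid_norm (y - x) * (kappa - euclid_norm (h x)) <=
  euclid_norm (h y) + euclid_norm (h x)
  + l%:R * (euclid_norm (y - x) ^+ 2 * C2norm (cube k) h).
Proof.
move=> hC2 Ux Uy hk; set e := euclid_norm (y - x).
have e0 : 0 <= e by exact: euclid_norm_ge0.
have [dh _ _ _] := C2onP hC2 x Ux.
have [E0|en0] := eqVneq e 0.
  rewrite E0 mul0r expr0n mul0r mulr0 addr0.
  by apply: addr_ge0; exact: euclid_norm_ge0.
have ep : 0 < e by rewrite lt_neqAle eq_sym en0.
pose S := \sum_i (y - x) 0 i *: partial i h x.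
have xiS : unit_sphere k (e^-1 *: (y - x)).
  by rewrite /unit_sphere /= euclid_normZ ger0_norm ?invr_ge0 // mulVf.
have ES : e * euclid_norm ('D_(e^-1 *: (y - x)) h x) = euclid_norm S.
  rewrite (derive_partial _ _ _ dh).
  have -> : \sum_i (e^-1 *: (y - x)) 0 i *: partial i h x = e^-1 *: S.
    by rewrite /S scaler_sumr; apply: eq_bigr => i _; rewrite mxE scalerA.
  by rewrite euclid_normZ ger0_norm ?invr_ge0 // mulVKf.
apply: (@le_trans _ _ (euclid_norm S)).
  by rewrite -ES ler_pM2l // lerBlDl; exact: hk.
pose r := h y - h x - S.
have -> : S = h y - h x - r by rewrite /r opprB addrCA subrr addr0.
apply: le_trans (euclid_normD _ _) _; apply: lerD.
  by apply: le_trans (euclid_normD _ _) _; rewrite euclid_normN.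
rewrite euclid_normN; apply: euclid_norm_le_max => a.
have -> : r 0 a = h y 0 a - h x 0 a - \sum_i (y 0 i - x 0 i) * partial i h x 0 a.
  rewrite /r !mxE summxE; congr (_ - _); apply: eq_bigr => i _.
  by rewrite !mxE.
apply: C2on_taylor => // i.
by have := normr_coord_le (y - x) i; rewrite !mxE.
Qed.
End Taylor.

(** * Coverings and doubling *)

Lemma card_bigcup_leq {I J : finType} (S : I -> {set J}) :
  (#|(\bigcup_i S i)%SET| <= \sum_i #|S i|)%N.
Proof.
elim/big_ind2 : _ => [|A m B n Am Bn|//]; first by rewrite cards0.
exact: leq_trans (leq_card_setU _ _) (leq_add Am Bn).
Qed.

Section Coverings.
Context {R : realType} {T : Type}.
Implicit Types (d : T -> T -> R) (E A : set T).

Lemma covering_number_le {d E delta A N} :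
  covered_by_balls d E delta A N -> (covering_number d E delta A <= (N%:R : R)%:E)%E.
Proof. by move=> AN; apply: ereal_inf_lbound; exists N. Qed.

(** An infimum of natural numbers is attained once it is finite. The slack [x + 1] only produces
    some cover, from which the least one is taken. *)
Lemma covering_numberP {d E delta A} {x : R} :
  (covering_number d E delta A <= x%:E)%E ->
  exists2 N, covered_by_balls d E delta A N & N%:R <= x.
Proof.
move=> Ax; have [_ [N AN <-] _] : exists2 y : \bar R,
    [set ((N%:R : R)%:E) | N in [set N | covered_by_balls d E delta A N]] y & (y < (x + 1)%:E)%E.
  by apply: ereal_inf_lt; apply: le_lt_trans Ax _; rewrite lte_fin ltrDl.
have exP : exists N, `[< covered_by_balls d E delta A N >] by exists N; exact/asboolP.
case: (ex_minnP exP) => M /asboolP AM Mmin; exists M => //.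
rewrite -lee_fin; apply: le_trans Ax; apply: le_ereal_inf_tmp => _ [N' AN' <-].
by rewrite lee_fin ler_nat; apply: Mmin; exact/asboolP.
Qed.

(** Turns the family into a finite type, over which sums and cardinals make sense: J is the type of
    attained indices. *)
Lemma finite_enum {I : finType} {F : set T} (iota : T -> I) :
  (forall f g, F f -> F g -> iota f = iota g -> f = g) ->
  exists (J : finType) (phi : J -> T),
    injective phi /\ forall f, F f <-> exists j, phi j = f.
Proof.
move=> iotaI; pose P (i : I) := `[< exists2 f, F f & iota f = i >].
pose J : finType := {i : I | P i}.
have /choice[phi phiP] (j : J) : exists f, F f /\ iota f = val j.
  by have /asboolP[f Ff fj] := valP j; exists f.
exists J, phi; split=> [i j ij|f].
  by apply: val_inj; rewrite -(phiP i).2 -(phiP j).2 ij.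
split=> [Ff|[j <-]]; last exact: (phiP j).1.
have Pf : P (iota f) by apply/asboolP; exists f.
exists (exist _ (iota f) Pf); apply: iotaI => //; first exact: (phiP _).1.
by rewrite (phiP _).2.
Qed.

Section Doubling.
Context {d : T -> T -> R} {E F : set T} {D : R}.
Hypothesis FE : F `<=` E.
Hypothesis dxx : forall x, E x -> d x x = 0.
Hypothesis dC : forall x y, E x -> E y -> d x y = d y x.
Hypothesis dD : forall x y z, E x -> E y -> E z -> d x z <= d x y + d y z.
Hypothesis FD : doubling d F D.

Let B := (Num.truncn D).+1.

Lemma doubling_step x r : F x -> 0 < r -> exists c : 'I_B -> T,
  (forall i, F (c i)) /\ forall y, F y -> d x y <= r ->
    exists i, d (c i) y <= r / 2.
Proof.
move=> Fx r0; have [N [c [Fc xc]] ND] := covering_numberP (FD x r Fx r0).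
have NB : (N <= B)%N.
  rewrite -(ler_nat R); apply: le_trans ND _.
  have [D0|D0] := leP 0 D; last by rewrite (le_trans (ltW D0)).
  by case/andP: (truncn_itv D0) => _ /ltW.
(* The cover is padded with copies of x to exactly B balls, so that iterated covers are indexed by
   products. *)
pose c' (i : 'I_B) := if insub (i : nat) is Some j then c (j : 'I_N) else x.
exists c'; split=> [i|y Fy xy]; first by rewrite /c'; case: insub => [j|].
have [i _ [_ iy]] := xc y (conj Fy xy).
by exists (widen_ord NB i); rewrite /c' /= valK.
Qed.

(** Halving can be repeated because the centres supplied by [doubling d F D] lie in F again. *)
Lemma doubling_iter j x r : F x -> 0 < r -> exists (I : finType) (c : I -> T),
  [/\ (#|I| <= B ^ j)%N, forall i, F (c i) & forall y, F y -> d x y <= r ->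
    exists i, d (c i) y <= r / 2 ^+ j].
Proof.
move=> Fx r0; elim: j => [|j [I [c [cI Fc cP]]]].
  exists unit, (fun=> x); split=> //; first by rewrite card_unit.
  by move=> y Fy xy; exists tt; rewrite expr0 divr1.
have rj0 : 0 < r / 2 ^+ j by rewrite divr_gt0 ?exprn_gt0.
have /choice[c' c'P] i := doubling_step (c i) _ (Fc i) rj0.
exists (I * 'I_B)%type, (fun p => c' p.1 p.2); split.
- by rewrite card_prod card_ord expnSr leq_mul2r cI orbT.
- by move=> p; exact: (c'P p.1).1.
move=> y Fy /(cP y Fy)[i /((c'P i).2 y Fy)[i' i'y]].
by exists (i, i'); rewrite exprSr invfM mulrA.
Qed.

Section Separated.
Context {delta : R}.
Hypothesis delta0 : 0 < delta.
Hypothesis Fsep : separated_set d delta F.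

Let close_eq c f g : F c -> F f -> F g -> d c f <= delta / 4 -> d c g <= delta / 4 -> f = g.
Proof.
move=> Fc Ff Fg cf cg; apply: contrapT => fg.
have := Fsep f g Ff Fg fg; apply/negP; rewrite -ltNge.
apply: (le_lt_trans (dD f c g (FE _ Ff) (FE _ Fc) (FE _ Fg))).
by rewrite (dC f c (FE _ Ff) (FE _ Fc)); move: cf cg delta0; lra.
Qed.

(** Two points of F in a ball of radius delta / 4 would be at distance at most delta / 2, so the
    small ball containing a point identifies it. *)
Lemma separated_index j x r : F x -> 0 < r -> r / 2 ^+ j <= delta / 4 ->
  exists (I : finType) (iota : T -> I), (#|I| <= B ^ j)%N /\
    forall f g, F f -> F g -> d x f <= r -> d x g <= r -> iota f = iota g -> f = g.
Proof.
move=> Fx r0 rj; have [I [c [cI Fc cP]]] := doubling_iter j x r Fx r0.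
have [i0 _] : exists i : I, True.
  by have [|i _] := cP x Fx; [rewrite (dxx _ (FE _ Fx)) ltW|exists i].
have /choice[iota iotaP] f : exists i, F f -> d x f <= r -> d (c i) f <= r / 2 ^+ j.
  have [[Ff xf]|nf] := pselect (F f /\ d x f <= r); last by exists i0 => *; case: nf.
  by have [i ci] := cP f Ff xf; exists i.
exists I, iota; split=> // f g Ff Fg xf xg fg.
apply: (close_eq (c (iota f))) => //; apply: le_trans rj; first exact: iotaP.
by rewrite fg; exact: iotaP.
Qed.

Lemma separated_enum x r : F x -> 0 < r -> (forall f, F f -> d x f <= r) ->
  exists (J : finType) (phi : J -> T),
    injective phi /\ forall f, F f <-> exists j, phi j = f.
Proof.
move=> Fx r0 xF.
have rd0 : 0 <= r / (delta / 4) by rewrite ltW // !divr_gt0.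
(* Since j < 2^j, this many halvings bring r below delta / 4. *)
pose j := (Num.truncn (r / (delta / 4))).+1.
have rj : r / 2 ^+ j <= delta / 4.
  rewrite ler_pdivrMr ?exprn_gt0 // mulrC -ler_pdivrMr ?divr_gt0 //.
  apply: le_trans (_ : j%:R <= _); first by case/andP: (truncn_itv rd0) => _ /ltW.
  by rewrite -natrX ler_nat ltnW // ltn_expl.
have [I [iota [_ iotaI]]] := separated_index j x r Fx r0 rj.
by apply: (finite_enum iota) => f g Ff Fg; apply: iotaI => //; exact: xF.
Qed.

(** The centre of a delta-ball may lie outside F, where the doubling condition says nothing; the
    ball is replaced by one of radius 2 delta about a point of F inside it. Three halvings take 2
    delta to delta / 4, hence the exponent 3. *)
Lemma separated_covering_card {J : finType} {phi : J -> T} {A : set T} {N} :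
  injective phi -> (forall j, F (phi j)) -> covered_by_balls d E delta A N ->
  (#|[set j | `[< A (phi j) >]]%SET| <= N * B ^ 3)%N.
Proof.
move=> phiI Fphi [c [Ec Ac]].
pose S (i : 'I_N) := [set j | `[< d (c i) (phi j) <= delta >]]%SET.
have cS i : (#|S i| <= B ^ 3)%N.
  have [->|[j0]] := finset.set_0Vmem (S i); first by rewrite cards0.
  rewrite inE => /asboolP ij0.
  have d20 : 0 < delta * 2 by rewrite mulr_gt0.
  have [|I [iota [cI iotaI]]] := separated_index 3 (phi j0) (delta * 2) (Fphi j0) d20.
    by rewrite !exprS expr0; move: delta0; lra.
  have near j : j \in S i -> d (phi j0) (phi j) <= delta * 2.
    rewrite inE => /asboolP ij.
    have Ep j' : E (phi j') by exact: FE.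
    by have := dD (phi j0) (c i) (phi j) (Ep _) (Ec i) (Ep _); rewrite (dC _ (c i)) //; lra.
  rewrite (leq_trans _ cI) // -(card_in_imset (f := iota \o phi)) ?max_card //.
  by move=> j j' jS j'S /= e; apply: phiI; apply: iotaI => //; exact: near.
apply: (@leq_trans #|(\bigcup_i S i)%SET|).
  apply/subset_leq_card/fintype.subsetP => j; rewrite inE => /asboolP /Ac[i _ [_ ij]].
  by apply/finset.bigcupP; exists i => //; rewrite inE; exact/asboolP.
apply: (leq_trans (card_bigcup_leq S)).
apply: (@leq_trans (\sum_(i < N) B ^ 3)); first by apply: leq_sum.
by rewrite sum_nat_const card_ord.
Qed.
End Separated.
End Doubling.
End Coverings.

(** * Cells and graphs *)

Section Cells.
Context {R : realType} {m : nat} {eta : R}.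
Hypothesis eta0 : 0 < eta.
Implicit Types p : 'rV[R]_m.

Definition grid : finType := {ffun 'I_m -> 'I_(Num.truncn eta^-1).+1}.

(** On the unit cube [p 0 i / eta] is at most [eta^-1], so [inord] does not fall back on its default
    there. *)
Definition cell p : grid := [ffun i => inord (Num.truncn (p 0 i / eta))].

Definition cells (S : set 'rV[R]_m) : {set grid} :=
  [set q | `[< exists2 p, S p & cell p = q >]]%SET.

Lemma cell_bounds p i : cube m p ->
  ((cell p i)%:R <= p 0 i / eta) && (p 0 i / eta < (cell p i)%:R + 1).
Proof.
move=> /(_ i)/andP[p0 p1].
have pe0 : 0 <= p 0 i / eta by rewrite divr_ge0 // ltW.
rewrite ffunE inordK; first by rewrite natr1; exact: truncn_itv.
rewrite ltnS; apply: le_truncn.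
by rewrite -[leRHS]mul1r ler_wpM2r // invr_ge0 ltW.
Qed.

Let dist_scale (x y a : R) : (`|x - y| <= a * eta) = (`|x / eta - y / eta| <= a).
Proof. by rewrite -mulrBl normrM normfV (gtr0_norm eta0) ler_pdivrMr. Qed.

Lemma cell_close p p' i : cube m p -> cube m p' -> cell p = cell p' ->
  `|p 0 i - p' 0 i| <= eta.
Proof.
move=> /(cell_bounds _ i)/andP[a b] /(cell_bounds _ i)/andP[a' b'] pp'.
rewrite pp' in a b; rewrite -[leRHS]mul1r dist_scale.
by rewrite ler_distl; lra.
Qed.

Lemma card_cells (S : set 'rV[R]_m) (a : nat) : S `<=` cube m ->
  (forall p p', S p -> S p' -> forall i, `|p 0 i - p' 0 i| <= a%:R * eta) ->
  (#|cells S| <= (2 * a).+1 ^ m)%N.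
Proof.
move=> SU Sa.
have [->|[q0]] := finset.set_0Vmem (cells S); first by rewrite cards0.
rewrite inE => /asboolP[p0 Sp0 _].
have [n0 n0E] : exists n0 : 'I_m -> nat, forall i, n0 i = cell p0 i.
  by exists (fun i => nat_of_ord (cell p0 i)).
have near q : q \in cells S -> forall i : 'I_m, (q i <= n0 i + a)%N && (n0 i <= q i + a)%N.
  rewrite inE => /asboolP[p Sp <-] i; rewrite n0E.
  have /andP[b1 b2] := cell_bounds p i (SU _ Sp).
  have /andP[c1 c2] := cell_bounds p0 i (SU _ Sp0).
  have := Sa p p0 Sp Sp0 i; rewrite dist_scale ler_distl => /andP[d1 d2].
  by apply/andP; split; rewrite -ltnS -(ltr_nat R) -natr1 natrD; lra.
(* Each coordinate of q is within a of that of the cell of p0, so the shifted coordinate lies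
   between 0 and 2a. *)
pose f (q : grid) : {ffun 'I_m -> 'I_(2 * a).+1} :=
  [ffun i => inord (q i + a - n0 i)].
have fI : {in cells S &, injective f}.
  move=> q q' qS q'S /ffunP qq'; apply/ffunP => i; apply: val_inj => /=.
  have := congr1 val (qq' i); rewrite !ffunE /=.
  have /andP[u1 u2] := near q qS i; have /andP[v1 v2] := near q' q'S i.
  have lt u : (u <= n0 i + a)%N -> (u + a - n0 i < (2 * a).+1)%N by lia.
  rewrite !inordK; [|exact: lt|exact: lt].
  move=> /(congr1 (addn^~ (n0 i))); rewrite !subnK // => /addIn; exact.
rewrite -(card_in_imset fI) (leq_trans (max_card _)) //.
by rewrite card_ffun !card_ord.
Qed.
End Cells.
Arguments grid {R} m eta.

Section GraphCells.
Context {R : realType}.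

Lemma card_cells_cover {m : nat} {eta : R} {I : finType} (S : set 'rV[R]_m)
    (P : I -> set 'rV[R]_m) (a : nat) : 0 < eta -> S `<=` cube m ->
  (forall p, S p -> exists i, P i p) ->
  (forall i p p', S p -> S p' -> P i p -> P i p' ->
    forall j, `|p 0 j - p' 0 j| <= a%:R * eta) ->
  (#|cells S : {set grid m eta}| <= #|I| * (2 * a).+1 ^ m)%N.
Proof.
move=> eta0 SU SP Pa.
apply: (@leq_trans #|(\bigcup_i (cells (S `&` P i) : {set grid m eta}))%SET|).
  apply/subset_leq_card/fintype.subsetP => q; rewrite inE => /asboolP[p Sp <-].
  have [i Pp] := SP p Sp; apply/finset.bigcupP; exists i => //.
  by rewrite inE; apply/asboolP; exists p.
apply: (leq_trans (card_bigcup_leq _)).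
apply: (@leq_trans (\sum_(i : I) (2 * a).+1 ^ m)); last by rewrite sum_nat_const.
apply: leq_sum => i _; apply: card_cells => //; first by move=> p [Sp _]; exact: SU.
by move=> p p' [Sp Pp] [Sp' Pp']; exact: Pa Pp Pp'.
Qed.

Lemma coord_dist_ball {m : nat} {c p q : 'rV[R]_m} {r : R} (j : 'I_m) :
  euclid_dist c p <= r -> euclid_dist c q <= r -> `|p 0 j - q 0 j| <= 2 * r.
Proof.
move=> cp cq; have := normr_coord_le (c - p) j; have := normr_coord_le (c - q) j.
rewrite !mxE => /le_trans/(_ cq) {}cq /le_trans/(_ cp) {}cp.
rewrite -[p 0 j](subrK (c 0 j)) -addrA.
apply: le_trans (ler_normD _ _) _; rewrite distrC; lra.
Qed.

Lemma card_cells_covering {m : nat} {delta : R} (S : set 'rV[R]_m) N :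
  (0 < m)%N -> 0 < delta -> S `<=` cube m ->
  covered_by_balls (@euclid_dist R m) setT delta S N ->
  (#|cells S : {set grid m (delta / m%:R)}| <= N * (2 * (2 * m)).+1 ^ m)%N.
Proof.
move=> m0 delta0 SU [c [_ Sc]]; have m0R : 0 < m%:R :> R by rewrite ltr0n.
rewrite -[in leqRHS](card_ord N).
apply: (card_cells_cover S (fun i => mball (@euclid_dist R m) setT (c i) delta)) => //.
- by rewrite divr_gt0.
- by move=> p /Sc[i _ ip]; exists i.
move=> i p p' _ _ [_ ip] [_ ip'] j.
have -> : (2 * m)%:R * (delta / m%:R) = 2 * delta.
  by rewrite natrM -mulrA (mulrC m%:R) divfK // gt_eqF.
exact: coord_dist_ball ip ip'.
Qed.

Context {k l : nat}.
Hypothesis k0 : (0 < k)%N.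
Implicit Types (X : set 'rV[R]_k) (f g : 'rV[R]_k -> 'rV[R]_l).

Lemma graph_overP X f p : graph_over X f p <->
  X (lsubmx p) /\ p = row_mx (lsubmx p) (f (lsubmx p)).
Proof.
by split=> [[x Xx <-]|[Xp pE]]; [rewrite row_mxKl|exists (lsubmx p)].
Qed.

Lemma row_mx_dist {x y : 'rV[R]_k} {u v : 'rV[R]_l} {b : R} :
  (forall i, `|x 0 i - y 0 i| <= b) -> (forall i, `|u 0 i - v 0 i| <= b) ->
  forall j, `|row_mx x u 0 j - row_mx y v 0 j| <= b.
Proof.
move=> xy uv j; case: (split_ordP j) => i ->.
  by rewrite !row_mxEl.
by rewrite !row_mxEr.
Qed.

(** One point of X is chosen in each cell met by the graph. Points with a common cell are at
    distance at most k times the side, hence at most delta. *)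
Lemma covering_le_cells {delta : R} {X f} : 0 < delta -> X `<=` cube k ->
  graph_over X f `<=` cube (k + l) ->
  covered_by_balls (@euclid_dist R k) (cube k) delta X
    #|cells (graph_over X f) : {set grid (k + l) (delta / (k + l)%:R)}|.
Proof.
move=> delta0 XU GU; set Q := cells _.
have kl0 : 0 < (k + l)%:R :> R by rewrite ltr0n addn_gt0 k0.
have eta0 : 0 < delta / (k + l)%:R by rewrite divr_gt0.
have /choice[x xP] (i : 'I_#|Q|) : exists x, X x /\
    cell (row_mx x (f x)) = enum_val i :> grid (k + l) (delta / (k + l)%:R).
  by have := enum_valP i; rewrite inE => /asboolP[_ [x Xx <-] xi]; exists x.
exists x; split=> [i|y Xy]; first exact/XU/(xP i).1.
have qQ : (cell (row_mx y (f y)) : grid (k + l) (delta / (k + l)%:R)) \in Q.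
  by rewrite inE; apply/asboolP; exists (row_mx y (f y)) => //; exists y.
exists (enum_rank_in qQ (cell (row_mx y (f y)))) => //; split; first exact: XU.
set i := enum_rank_in _ _; have [Xi] := xP i; rewrite enum_rankK_in // => ci.
apply: le_trans (_ : k%:R * (delta / (k + l)%:R) <= _); last first.
  rewrite mulrCA ger_pMr // ler_pdivrMr // mul1r ler_nat leq_addr //.
apply: euclid_norm_le_max => j; rewrite !mxE.
have := cell_close eta0 _ _ (lshift l j) (GU (row_mx (x i) (f (x i))) _) (GU (row_mx y (f y)) _) ci.
by rewrite !row_mxEl; apply; [exists (x i)|exists y].
Qed.

(** Above a delta-ball the coordinates of graph points vary by at most 2 delta in the base and 2
    delta L in the values; [2 * (1 + L) * (k + l)%:R] bounds both in units of the side. *)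
Lemma card_graph_cells {delta L : R} {X f} {N a : nat} : 0 < delta -> X `<=` cube k ->
  graph_over X f `<=` cube (k + l) -> C2on (cube k) f -> C2norm (cube k) f <= L ->
  2 * (1 + L) * (k + l)%:R <= a%:R ->
  covered_by_balls (@euclid_dist R k) (cube k) delta X N ->
  (#|cells (graph_over X f) : {set grid (k + l) (delta / (k + l)%:R)}|
    <= N * (2 * a).+1 ^ (k + l))%N.
Proof.
move=> delta0 XU GU fC2 fL La [c [_ Xc]].
have kl0 : 0 < (k + l)%:R :> R by rewrite ltr0n addn_gt0 k0.
have eta0 : 0 < delta / (k + l)%:R by rewrite divr_gt0.
have L0 : 0 <= L := le_trans (C2norm_ge0 fC2) fL.
rewrite -[in leqRHS](card_ord N).
apply: (card_cells_cover _
  (fun i p => mball (@euclid_dist R k) (cube k) (c i) delta (lsubmx p))) => //.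
  by move=> p /graph_overP[/Xc[i _ ip] _]; exists i.
move=> i p p' /graph_overP[Xp ->] /graph_overP[Xp' ->]; rewrite !row_mxKl.
set x := lsubmx p; set y := lsubmx p' => -[_ ix] [_ iy].
have xy j : `|x 0 j - y 0 j| <= 2 * delta := coord_dist_ball j ix iy.
have d2 : 0 <= 2 * delta by rewrite mulr_ge0 // ltW.
have La' : 2 * delta * (1 + L) <= a%:R * (delta / (k + l)%:R).
  rewrite mulrA ler_pdivlMr //.
  by have := ler_wpM2r (ltW delta0) La; lra.
apply: row_mx_dist => j.
  apply: le_trans (xy j) (le_trans _ La').
  by rewrite ler_peMr // lerDl.
apply: le_trans (C2on_lipschitz f y x j (2 * delta) fC2 (XU _ Xp') (XU _ Xp) d2 xy) _.
apply: le_trans La'; apply: ler_wpM2l => //.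
by apply: le_trans fL _; rewrite lerDr.
Qed.
End GraphCells.

(** * Common cells of two graphs *)

Section PairBound.
Context {R : realType} {k l : nat}.
Hypotheses (k0 : (0 < k)%N) (l0 : (0 < l)%N).
Implicit Types (X Y : set 'rV[R]_k) (f g h : 'rV[R]_k -> 'rV[R]_l).

(** Write kappa for [K^-1 * C2norm (cube k) h] and e for the distance. As |h(x)| is at most kappa /
    2, the left side of [transversal_dist] is at least e kappa / 2; the bound on e makes the
    remainder at most e kappa / 4. What is left is e kappa / 4 <= 2 t. *)
Lemma transversal_close h x y (K t : R) : 0 < K -> C2on (cube k) h ->
  cube k x -> cube k y ->
  (forall xi, unit_sphere k xi ->
    K^-1 * C2norm (cube k) h <= euclid_norm (h x) + euclid_norm ('D_xi h x)) ->
  euclid_norm (h x) <= t -> euclid_norm (h y) <= t ->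
  2 * t <= K^-1 * C2norm (cube k) h ->
  euclid_norm (y - x) <= (4 * K * l%:R)^-1 ->
  euclid_norm (y - x) * C2norm (cube k) h <= 8 * K * t.
Proof.
move=> K0 hC2 Ux Uy hK hx hy td xy.
have := transversal_dist _ _ _ _ hC2 Ux Uy hK.
have := euclid_norm_ge0 (y - x); have := C2norm_ge0 hC2.
move: (euclid_norm (y - x)) (C2norm (cube k) h) xy td => e d xy td d0 e0 H.
have l0R : 0 < l%:R :> R by rewrite ltr0n.
have e1 : e * l%:R * K <= 4^-1.
  move: xy; rewrite invfM ler_pdivlMr // invfM ler_pdivlMr //; lra.
set kappa := K^-1 * d in td H.
have dK : d = K * kappa by rewrite /kappa mulVKf // gt_eqF.
have kappa0 : 0 <= kappa by rewrite mulr_ge0 // invr_ge0 ltW.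
have H1 : e * (kappa / 2) <= e * (kappa - euclid_norm (h x)).
  by apply: ler_wpM2l => //; lra.
have H2 : (e * l%:R * K) * (e * kappa) <= 4^-1 * (e * kappa).
  by apply: ler_wpM2r => //; exact: mulr_ge0.
have H3 : l%:R * (e ^+ 2 * d) = (e * l%:R * K) * (e * kappa) by rewrite dK; ring.
rewrite H3 in H.
have -> : e * d = K * (e * kappa) by rewrite dK; ring.
have -> : 8 * K * t = K * (8 * t) by ring.
by apply: ler_wpM2l; [exact: ltW|lra].
Qed.

(** Common cells come from points x with |h(x)| <= (1 + L) delta. A coarse grid of side
    [(4 * K * l%:R)^-1 / k%:R] cuts the cube into pieces small enough for [transversal_close], and
    in each piece these x lie in a single ball. *)
Lemma card_cellsI {K L delta b : R} {a : nat} {X Y f g} :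
  0 < K -> 0 < delta -> C2on (cube k) f -> C2on (cube k) g ->
  C2norm (cube k) f <= L -> C2norm (cube k) g <= L ->
  2 * (1 + L) * (k + l)%:R <= a%:R ->
  X `<=` cube k -> Y `<=` cube k ->
  graph_over X f `<=` cube (k + l) -> graph_over Y g `<=` cube (k + l) ->
  (forall x xi, cube k x -> unit_sphere k xi -> K^-1 * C2norm (cube k) (f \- g)
    <= euclid_norm (f x - g x) + euclid_norm ('D_xi f x - 'D_xi g x)) ->
  2 * ((1 + L) * delta) <= K^-1 * C2norm (cube k) (f \- g) ->
  0 < C2norm (cube k) (f \- g) ->
  (forall z, cube k z -> exists2 N,
    covered_by_balls (@euclid_dist R k) (cube k) delta
      (X `&` mball (@euclid_dist R k) (cube k) z
        (8 * K * ((1 + L) * delta) / C2norm (cube k) (f \- g))) N &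
    N%:R <= b) ->
  #|(cells (graph_over X f) :&: cells (graph_over Y g)
      : {set grid (k + l) (delta / (k + l)%:R)})%SET|%:R
  <= #|grid k ((4 * K * l%:R)^-1 / k%:R)|%:R * (b * ((2 * a).+1 ^ (k + l))%:R).
Proof.
move=> K0 delta0 fC2 gC2 fL gL La XU YU GX GY cin td d0 Xb.
set h := f \- g in cin td d0 Xb *; set d := C2norm _ h in cin td d0 Xb.
set t := (1 + L) * delta in td Xb; set rho := 8 * K * t / d in Xb.
have hC2 : C2on (cube k) h := C2onB fC2 gC2.
have L0 : 0 <= L := le_trans (C2norm_ge0 fC2) fL.
have kl0 : 0 < (k + l)%:R :> R by rewrite ltr0n addn_gt0 k0.
have l0R : 0 < l%:R :> R by rewrite ltr0n.
have k0R : 0 < k%:R :> R by rewrite ltr0n.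
set eta := delta / (k + l)%:R; have eta0 : 0 < eta by rewrite divr_gt0.
have r0 : 0 < (4 * K * l%:R)^-1 / k%:R by rewrite divr_gt0 // invr_gt0 !mulr_gt0.
have hD x xi : cube k x -> 'D_xi h x = 'D_xi f x - 'D_xi g x.
  move=> Ux; have [df _ _ _] := C2onP fC2 x Ux; have [dg _ _ _] := C2onP gC2 x Ux.
  by apply: deriveB; [exact: diff_derivable df|exact: diff_derivable dg].
pose W := X `&` [set x | euclid_norm (h x) <= t].
(* The centre is a point of W in the piece, or any point of the cube if the piece misses W. *)
have /choice[z zP] (tau : grid k ((4 * K * l%:R)^-1 / k%:R)) : exists z, cube k z /\
    forall x, W x -> cell x = tau -> mball (@euclid_dist R k) (cube k) z rho x.
  have [[z [Xz zt] zc]|nW] := pselect (exists2 z, W z & cell z = tau); last first.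
    have [z Uz] := @cube_nonempty R k; exists z; split=> // x Wx xc.
    by case: nW; exists x.
  exists z; split; first exact: XU.
  move=> x [Xx xt] xc; split; first exact: XU.
  rewrite /rho ler_pdivlMr // /euclid_dist -euclid_normN opprB.
  apply: (transversal_close h z x K t) => //; [exact: XU|exact: XU| |].
    by move=> xi xi1; rewrite hD; [exact: cin (XU _ Xz) xi1|exact: XU].
  apply: le_trans (_ : k%:R * ((4 * K * l%:R)^-1 / k%:R) <= _); last first.
    by rewrite mulrC divfK // gt_eqF.
  apply: euclid_norm_le_max => i; rewrite !mxE.
  by apply: cell_close; [|exact: XU|exact: XU|rewrite xc zc].
pose Xz tau := X `&` mball (@euclid_dist R k) (cube k) (z tau) rho.
have /choice[N NP] tau : exists N,
    covered_by_balls (@euclid_dist R k) (cube k) delta (Xz tau) N /\ N%:R <= b.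
  by have [N XN Nb] := Xb (z tau) (zP tau).1; exists N.
pose Q tau : {set grid (k + l) eta} := cells (graph_over (Xz tau) f).
have QN tau : (#|Q tau| <= N tau * (2 * a).+1 ^ (k + l))%N.
  apply: (card_graph_cells k0 delta0 _ _ fC2 fL La (NP tau).1).
    by move=> x [Xx _]; exact: XU.
  by move=> _ [x [Xx _] <-]; apply: GX; exists x.
have sQ : cells (graph_over X f) :&: cells (graph_over Y g) \subset (\bigcup_tau Q tau)%SET.
  apply/fintype.subsetP => q; rewrite !inE => /andP[/asboolP[_ [x Xx <-] xq]].
  move=> /asboolP[_ [y Yy <-] yq].
  (* f(x) and g(y) differ by at most eta in each coordinate, and g(y) and g(x) by at most L eta
     because x and y share a cell as well. *)
  have Wx : W x.
    split=> //=; apply: le_trans (_ : l%:R * ((1 + L) * eta) <= _); last first.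
      rewrite mulrCA; apply: ler_wpM2l; first by rewrite addr_ge0.
      by rewrite mulrCA ger_pMr // ler_pdivrMr // mul1r ler_nat leq_addl.
    have close j := cell_close eta0 _ _ j (GX (row_mx x (f x)) (ex_intro2 _ _ x Xx erefl))
      (GY (row_mx y (g y)) (ex_intro2 _ _ y Yy erefl)) (etrans xq (esym yq)).
    have xy i : `|y 0 i - x 0 i| <= eta.
      by have := close (lshift l i); rewrite !row_mxEl distrC.
    apply: euclid_norm_le_max => j; have := close (rshift k j); rewrite !row_mxEr => fgj.
    have := C2on_lipschitz g x y j eta gC2 (XU _ Xx) (YU _ Yy) (ltW eta0) xy.
    move=> /le_trans/(_ (ler_wpM2l (ltW eta0) gL)) gj.
    rewrite /h !mxE -[f x 0 j](subrK (g y 0 j)) -addrA.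
    apply: le_trans (ler_normD _ _) (le_trans (lerD fgj gj) _).
    by rewrite mulrDl mul1r (mulrC L).
  apply/finset.bigcupP; exists (cell x) => //; rewrite inE; apply/asboolP.
  exists (row_mx x (f x)) => //; exists x => //.
  by split=> //; exact: (zP _).2.
apply: le_trans (_ : (\sum_tau #|Q tau|)%:R <= _).
  rewrite ler_nat; apply: leq_trans (card_bigcup_leq Q).
  exact: subset_leq_card.
rewrite natr_sum.
apply: le_trans (_ : \sum_(tau : grid k ((4 * K * l%:R)^-1 / k%:R))
  b * ((2 * a).+1 ^ (k + l))%:R <= _); last by rewrite sumr_const -[leLHS]mulr_natl.
apply: ler_sum => tau _.
apply: le_trans (_ : (N tau * (2 * a).+1 ^ (k + l))%:R <= _).
  by rewrite ler_nat.
by rewrite natrM ler_wpM2r // (NP tau).2.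
Qed.
End PairBound.

(** * Double counting over dyadic scales *)

Section DoubleCounting.
Context {R : realType}.

Lemma double_counting {J G : finType} (Q : J -> {set G}) (M P : R) :
  0 <= M -> (forall j, M <= #|Q j|%:R) ->
  (forall j, \sum_j' #|Q j :&: Q j'|%:R <= P) -> (0 < #|J|)%N ->
  M ^+ 2 * #|J|%:R <= #|(\bigcup_j Q j)%SET|%:R * P.
Proof.
move=> M0 MQ QP J0; have J0R : 0 < #|J|%:R :> R by rewrite ltr0n.
pose chi j q : R := (q \in Q j)%:R.
(* The multiplicity of q; its sum of squares counts the triples of two indices and a common cell. *)
pose n q := \sum_j chi j q.
pose a q : R := (q \in (\bigcup_j Q j)%SET)%:R.
have sum_chi (A : {set G}) : \sum_q (q \in A)%:R = #|A|%:R :> R.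
  by rewrite -sum1_card natr_sum [in RHS]big_mkcond; apply: eq_bigr => q _; case: (q \in A).
have an q : a q * n q = n q.
  rewrite /a; case: (boolP (q \in _)) => [|qN]; first by rewrite mul1r.
  rewrite mul0r /n big1 // => j _; rewrite /chi; case: (boolP (q \in Q j)) => // qQ.
  by case/negP: qN; apply/finset.bigcupP; exists j.
have sum_n : \sum_q n q = \sum_j #|Q j|%:R.
  by rewrite exchange_big; apply: eq_bigr => j _; rewrite sum_chi.
have sum_n2 : \sum_q n q ^+ 2 <= #|J|%:R * P.
  have -> : \sum_q n q ^+ 2 = \sum_j \sum_j' #|Q j :&: Q j'|%:R.
    under eq_bigr do rewrite expr2 mulr_suml.
    rewrite exchange_big; apply: eq_bigr => j _ /=.
    under eq_bigr do rewrite mulr_sumr.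
    rewrite exchange_big; apply: eq_bigr => j' _ /=.
    rewrite -sum_chi; apply: eq_bigr => q _.
    rewrite /chi finset.in_setI.
    by case: (q \in Q j); case: (q \in Q j'); rewrite ?mulr1 ?mulr0 ?mul0r.
  apply: le_trans (_ : \sum_(j : J) P <= _); first by apply: ler_sum.
  by rewrite sumr_const -[leLHS]mulr_natl.
have := cauchy_schwarz_sum a n.
rewrite (eq_bigr n (fun q _ => an q)).
have -> : \sum_q a q ^+ 2 = #|(\bigcup_j Q j)%SET|%:R.
  by rewrite -sum_chi; apply: eq_bigr => q _; rewrite /a; case: (q \in _); rewrite ?expr1n ?expr0n.
rewrite sum_n => cs.
have MJ : M * #|J|%:R <= \sum_j #|Q j|%:R.
  rewrite mulr_natr -sumr_const; apply: ler_sum => j _; exact: MQ.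
rewrite -(ler_pM2r J0R).
have -> : M ^+ 2 * #|J|%:R * #|J|%:R = (M * #|J|%:R) ^+ 2 by ring.
apply: le_trans (_ : (\sum_j #|Q j|%:R) ^+ 2 <= _).
  rewrite ler_pXn2r // nnegrE; first exact: mulr_ge0.
  exact: sumr_ge0.
apply: le_trans cs _; rewrite -mulrA [P * _]mulrC.
exact: ler_wpM2l.
Qed.

(** Each j is charged to the least i with [dist j <= 2 ^+ i * delta]. Minimality gives the lower
    bound on [dist j] except when i = 0, which covers the nearest indices. The scale i contributes
    P0 P1 2^(i (s - s')), at most P0 P1. *)
Lemma dyadic_sum {J : finType} (dist c : J -> R) (delta s s' P0 P1 : R) (I : nat) :
  0 <= P0 -> 0 <= P1 -> s <= s' ->
  (forall j, dist j <= 2 ^+ I * delta) ->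
  (forall j i, dist j <= 2 ^+ i * delta ->
    i = 0%N \/ 2 ^+ i * delta < 2 * dist j -> c j <= P0 * (2 ^+ i) `^ (- s')) ->
  (forall i, #|[set j | dist j <= 2 ^+ i * delta]%SET|%:R <= P1 * (2 ^+ i) `^ s) ->
  \sum_j c j <= I.+1%:R * (P0 * P1).
Proof.
move=> P00 P10 ss' dI cP nP.
pose w (i : nat) := P0 * (2 ^+ i) `^ (- s').
have w0 i : 0 <= w i by rewrite mulr_ge0 // powR_ge0.
have cw j : c j <= \sum_(i < I.+1) (dist j <= 2 ^+ i * delta)%R%:R * w i.
  have ex : exists i, dist j <= 2 ^+ i * delta by exists I.
  case: (ex_minnP ex) => i di imin.
  have iI : (i < I.+1)%N by rewrite ltnS; apply: imin.
  rewrite (bigD1 (Ordinal iI)) //= di mul1r -[leLHS]addr0; apply: lerD.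
    apply: cP => //; case: i di imin {iI} => [|i] di imin; [by left|right].
    have : ~~ (dist j <= 2 ^+ i * delta) by apply/negP => /imin; rewrite ltnn.
    by rewrite -ltNge exprS -mulrA ltr_pM2l.
  by apply: sumr_ge0 => i' _; rewrite mulr_ge0.
apply: le_trans (ler_sum _ (fun j _ => cw j)) _; rewrite exchange_big /=.
apply: le_trans (_ : \sum_(i < I.+1) P0 * P1 <= _); last first.
  by rewrite sumr_const card_ord -[leLHS]mulr_natl.
apply: ler_sum => i _; rewrite -mulr_suml.
have -> : \sum_j (dist j <= 2 ^+ i * delta)%R%:R =
    #|[set j | dist j <= 2 ^+ i * delta]%SET|%:R :> R.
  by rewrite -sum1_card natr_sum [in RHS]big_mkcond; apply: eq_bigr => j _; rewrite inE; case: ifP.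
apply: le_trans (ler_wpM2r (w0 i) (nP i)) _.
have p20 : 2 ^+ i != 0 :> R by rewrite expf_neq0.
have -> : P1 * (2 ^+ i) `^ s * w i = P0 * P1 * (2 ^+ i) `^ (s - s').
  by rewrite powRD ?p20 ?implybT // /w; ring.
apply: ler_piMr; first exact: mulr_ge0.
rewrite -[leRHS](powRr0 (2 ^+ i)); apply: ler_powR; first by rewrite exprn_ege1 // ler1n.
by rewrite subr_le0.
Qed.

Lemma dyadic_scales (K : R) : exists2 CK : R, 0 < CK &
  forall delta, 0 < delta <= 1 -> exists2 I : nat,
    K <= 2 ^+ I * delta & I.+1%:R <= CK * (1 + ln delta^-1).
Proof.
pose K1 := Num.max 1 K; have K11 : 1 <= K1 by rewrite le_max lexx.
have K10 : 0 < K1 := lt_le_trans ltr01 K11.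
have ln2 : 0 < ln 2 :> R by rewrite ln_gt0 // ltr1n.
have lnK : 0 <= ln K1 by rewrite ln_ge0.
(* The number of scales is at most 2 + (ln K1 + ln (1 / delta)) / ln 2; K1 >= 1 keeps all terms
   nonnegative. *)
exists (2 + (ln K1 + 1) / ln 2); first by rewrite addr_gt0 // divr_gt0 // ltr_wpDl.
move=> delta /andP[d0 d1]; have di1 : 1 <= delta^-1 by rewrite invf_ge1.
have lnd : 0 <= ln delta^-1 by rewrite ln_ge0.
pose y := ln (K1 / delta) / ln 2.
have Ey : ln (K1 / delta) = ln K1 + ln delta^-1 by rewrite lnM ?posrE ?invr_gt0.
have y0 : 0 <= y by rewrite divr_ge0 ?(ltW ln2) // Ey addr_ge0.
have /andP[yI Iy] := truncn_itv y0.
exists (Num.truncn y).+1.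
  apply: le_trans (_ : K1 <= _); first by rewrite le_max lexx orbT.
  rewrite -ler_pdivrMr // -ler_ln ?posrE ?exprn_gt0 ?divr_gt0 // lnXn // -[leRHS]mulr_natl.
  by rewrite -ler_pdivrMr // ltW.
rewrite -[X in X%:R <= _]addn2 natrD; apply: le_trans (lerD yI (lexx _)) _.
rewrite /y Ey mulrDl.
have q0 : 0 <= ln delta^-1 / ln 2 by rewrite divr_ge0 // (ltW ln2).
have q1 : 0 <= ln K1 / ln 2 by rewrite divr_ge0 // (ltW ln2).
have q2 : 0 <= ln K1 / ln 2 * ln delta^-1 by rewrite mulr_ge0.
have -> : (2 + (ln K1 + 1) / ln 2) * (1 + ln delta^-1) =
  2 + ln K1 / ln 2 + (ln 2)^-1 + 2 * ln delta^-1 + ln K1 / ln 2 * ln delta^-1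
  + ln delta^-1 / ln 2 by ring.
have : 0 <= (ln 2)^-1 :> R by rewrite invr_ge0 ltW.
by lra.
Qed.

(** From ln x < x at x = delta^-eps one gets ln (1 / delta) <= eps^-1 delta^-eps, and the threshold
    on delta says exactly that eps^-1 <= delta^-eps. *)
Lemma ln_inv_le_powR (eps delta : R) : 0 < eps -> 0 < delta -> delta <= eps `^ eps^-1 ->
  ln delta^-1 <= delta `^ (- (2 * eps)).
Proof.
move=> e0 d0 de.
have p0 : 0 < delta `^ (- eps) by rewrite powR_gt0.
have L : eps * ln delta^-1 <= delta `^ (- eps).
  rewrite lnV ?posrE // mulrN -mulNr -ln_powR.
  by apply: ltW; apply: ln_sublinear.
have de' : delta `^ eps <= eps.
  apply: le_trans (_ : (eps `^ eps^-1) `^ eps <= _).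
    by apply: ge0_ler_powR; rewrite ?nnegrE ?powR_ge0 ?(ltW e0) ?(ltW d0).
  by rewrite -powRrM mulVf ?gt_eqF // powRr1 // ltW.
have -> : - (2 * eps) = - eps + - eps by ring.
rewrite powRD ?(gt_eqF d0) ?implybT //.
have ei : eps^-1 <= delta `^ (- eps).
  by rewrite powRN lef_pV2 // posrE // powR_gt0.
apply: le_trans (_ : eps^-1 * delta `^ (- eps) <= _).
  by rewrite ler_pdivlMl.
by apply: ler_wpM2r => //; exact: ltW.
Qed.
End DoubleCounting.

(** * The bound for a pair at a given scale *)

Section PairConstant.
Context {R : realType}.

(** [1 + 16 * K * (1 + L)] is the scale separating near pairs from distant ones. Its exponent k
    bounds s', which keeps the constant independent of s'. *)
Definition pair_const (k l a : nat) (K L : R) : R :=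
  ((2 * a).+1 ^ (k + l))%:R * (#|grid k ((4 * K * l%:R)^-1 / k%:R)|%:R + 1)
  * (1 + 16 * K * (1 + L)) `^ k%:R.

(** With p = 2^i, these are the conditions for a distant pair: transversality beats the error (1 +
    L) delta, and the radius of the ball is at least delta, as the non-concentration condition on X
    demands, and at most a constant over p. *)
Lemma scale_arith {K L delta d p : R} : 0 < K -> 0 <= L -> 0 < delta -> 0 < p ->
  d <= K -> p * delta < 2 * d -> 1 + 16 * K * (1 + L) <= p ->
  [/\ 0 < d, 2 * ((1 + L) * delta) <= K^-1 * d,
      delta <= 8 * K * ((1 + L) * delta) / d &
      8 * K * ((1 + L) * delta) / d <= (1 + 16 * K * (1 + L)) * p^-1].
Proof.
move=> K0 L0 delta0 p0 dK di Ap.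
have pd0 : 0 < p * delta by rewrite mulr_gt0.
have d0 : 0 < d by lra.
have KLd0 : 0 <= K * L * delta by rewrite !mulr_ge0 // ltW.
have Kd0 : 0 <= K * delta by rewrite mulr_ge0 // ltW.
have Apd : (1 + 16 * K * (1 + L)) * delta <= p * delta by rewrite ler_pM2r.
split=> //.
- by rewrite ler_pdivlMl //; lra.
- rewrite ler_pdivlMr // mulrC.
  have : d * delta <= K * delta by rewrite ler_pM2r.
  by lra.
rewrite ler_pdivrMr // [leRHS]mulrAC ler_pdivlMr //.
have K1 : 0 <= K * (1 + L) by rewrite mulr_ge0 ?addr_ge0 // ltW.
have : K * (1 + L) * (p * delta) <= K * (1 + L) * (2 * d).
  by rewrite ler_wpM2l // ltW.
by lra.
Qed.

Lemma pair_bound {k l a : nat} {K L delta s' C M : R} {X Y f g} (i : nat) :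
  (0 < k)%N -> (0 < l)%N -> 0 < K -> 0 < delta -> 0 < s' <= k%:R -> 1 <= C ->
  C2on (cube k) f -> C2on (cube k) g ->
  C2norm (cube k) f <= L -> C2norm (cube k) g <= L ->
  2 * (1 + L) * (k + l)%:R <= a%:R ->
  delta_s_set (@euclid_dist R k) (cube k) delta s' C X ->
  covering_number (@euclid_dist R k) (cube k) delta X = M%:E ->
  Y `<=` cube k ->
  graph_over X f `<=` cube (k + l) -> graph_over Y g `<=` cube (k + l) ->
  (forall x xi, cube k x -> unit_sphere k xi -> K^-1 * C2norm (cube k) (f \- g)
    <= euclid_norm (f x - g x) + euclid_norm ('D_xi f x - 'D_xi g x)) ->
  C2dist (cube k) f g <= K ->
  i = 0%N \/ 2 ^+ i * delta < 2 * C2dist (cube k) f g ->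
  #|(cells (graph_over X f) :&: cells (graph_over Y g)
      : {set grid (k + l) (delta / (k + l)%:R)})%SET|%:R
  <= pair_const k l a K L * C * M * (2 ^+ i) `^ (- s').
Proof.
move=> k0 l0 K0 delta0 /andP[s0 sk] C1 fC2 gC2 fL gL La [XU _ Xs] XM YU GX GY cin dK di.
have L0 : 0 <= L := le_trans (C2norm_ge0 fC2) fL.
set B := ((2 * a).+1 ^ (k + l))%:R : R; have B0 : 0 <= B by rewrite ler0n.
set T := #|grid k ((4 * K * l%:R)^-1 / k%:R)|%:R : R; have T0 : 0 <= T by rewrite ler0n.
have KL0 : 0 <= K * (1 + L) by rewrite mulr_ge0 ?(ltW K0) ?addr_ge0.
set A := 1 + 16 * K * (1 + L).
have A1 : 1 <= A by rewrite lerDl -mulrA mulr_ge0.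
have [N XN NM] : exists2 N, covered_by_balls (@euclid_dist R k) (cube k) delta X N & N%:R <= M.
  by apply: covering_numberP; rewrite XM.
have M0 : 0 <= M := le_trans (ler0n _ _) NM.
have C0 : 0 <= C := le_trans ler01 C1.
have p0 : 0 < 2 ^+ i :> R by rewrite exprn_gt0.
(* For near pairs all cells of one graph are counted, and [A]^ k%:R[compensates the factor](2 ^+ i)
   [^ (- s')]. *)
have [iA|iA] := leP (2 ^+ i) A.
  apply: le_trans (_ : B * M <= _).
    apply: le_trans (_ : (N * (2 * a).+1 ^ (k + l))%:R <= _).
      rewrite ler_nat.
      apply: leq_trans (card_graph_cells k0 delta0 XU GX fC2 fL La XN).
      exact/subset_leq_card/finset.subsetIl.
    by rewrite natrM mulrC ler_wpM2l.
  have : 1 <= A `^ k%:R * (2 ^+ i) `^ (- s').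
    rewrite powRN ler_pdivlMr ?powR_gt0 // mul1r.
    apply: le_trans (_ : A `^ s' <= _); last exact: ler_powR.
    by apply: ge0_ler_powR; rewrite ?nnegrE ?(ltW s0) ?(ltW p0) // (le_trans ler01).
  set w := A `^ _ * _ => w1.
  have -> : pair_const k l a K L * C * M * (2 ^+ i) `^ (- s') = B * M * ((T + 1) * C * w).
    by rewrite /pair_const -/B -/T -/A /w; ring.
  apply: ler_peMr; first exact: mulr_ge0.
  apply: mulr_ege1 => //; apply: mulr_ege1 => //.
  by rewrite lerDr.
case: di => [i0|di]; first by rewrite i0 expr0 ltNge A1 in iA.
set d := C2dist (cube k) f g in dK di; rewrite -/(C2dist (cube k) f g) -/d in cin.
have [dpos dA rho_ge rho_le] := scale_arith K0 L0 delta0 p0 dK di (ltW iA).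
set rho := 8 * K * ((1 + L) * delta) / d in rho_ge rho_le.
pose b := C * rho `^ s' * M.
have := card_cellsI k0 l0 (b := b) K0 delta0 fC2 gC2 fL gL La XU YU GX GY cin.
rewrite -/(C2dist (cube k) f g) -/d -/rho -/B -/T => /(_ _ dpos) H.
apply: le_trans (H _ _) _.
- exact: dA.
- move=> z Uz; apply: covering_numberP.
  apply: le_trans (Xs z rho Uz rho_ge) _.
  by rewrite XM -EFinM lee_fin.
have rs : rho `^ s' <= A `^ k%:R * (2 ^+ i) `^ (- s').
  apply: le_trans (_ : (A * (2 ^+ i)^-1) `^ s' <= _).
    apply: ge0_ler_powR; rewrite ?nnegrE ?(ltW s0) //.
      exact: le_trans (ltW delta0) rho_ge.
    by rewrite mulr_ge0 ?invr_ge0 ?(ltW p0) // (le_trans ler01).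
  rewrite powRM ?invr_ge0 ?(ltW p0) ?(le_trans ler01) //.
  rewrite -[(2 ^+ i)^-1]powR_inv1 ?(ltW p0) // -powRrM mulN1r.
  by apply: ler_wpM2r; rewrite ?powR_ge0 // ler_powR.
apply: le_trans (_ : T * (C * (A `^ k%:R * (2 ^+ i) `^ (- s')) * M * B) <= _).
  apply: ler_wpM2l => //; apply: ler_wpM2r => //; apply: ler_wpM2r => //.
  exact: ler_wpM2l.
have -> : pair_const k l a K L * C * M * (2 ^+ i) `^ (- s')
   = (T + 1) * (C * (A `^ k%:R * (2 ^+ i) `^ (- s')) * M * B).
  by rewrite /pair_const -/B -/T -/A; ring.
by apply: ler_wpM2r; [rewrite !mulr_ge0 ?powR_ge0|rewrite lerDl].
Qed.
End PairConstant.

(** Passes from covering numbers to cardinals: |F|_delta is at most the cardinal of F, and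
    separation with doubling reverses this up to a constant on each ball. *)
Lemma neighbor_count {R : realType} {T : Type} {d : T -> T -> R} {E F : set T}
    {D delta s C : R} {J : finType} {phi : J -> T} (x : T) (r : R) :
  (forall x, E x -> d x x = 0) ->
  (forall x y, E x -> E y -> d x y = d y x) ->
  (forall x y z, E x -> E y -> E z -> d x z <= d x y + d y z) ->
  doubling d F D -> 0 < delta -> separated_set d delta F ->
  delta_s_set d E delta s C F -> 0 <= C ->
  injective phi -> (forall f, F f <-> exists j, phi j = f) ->
  E x -> delta <= r ->
  #|[set j | d x (phi j) <= r]%SET|%:R
    <= ((Num.truncn D).+1 ^ 3)%:R * (C * r `^ s * #|J|%:R).
Proof.
move=> dxx dC dD FD delta0 Fsep [FE _ Fs] C0 phiI phiP Ex dr.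
have Fphi j : F (phi j) by apply/phiP; exists j.
have FJ : (covering_number d E delta F <= (#|J|%:R : R)%:E)%E.
  apply: covering_number_le; exists (fun i => phi (enum_val i)).
  split=> [i|f Ff]; first exact/FE/Fphi.
  have /phiP[j jf] := Ff; exists (enum_rank j) => //; split; first exact: FE.
  by rewrite enum_rankK jf dxx ?ltW //; exact: FE.
have [N AN Nb] : exists2 N, covered_by_balls d E delta (F `&` mball d E x r) N &
    N%:R <= C * r `^ s * #|J|%:R.
  apply: covering_numberP; apply: le_trans (Fs x r Ex dr) _.
  by rewrite [leRHS]EFinM lee_wpmul2l // lee_fin mulr_ge0 // powR_ge0.
have cN := separated_covering_card FE dxx dC dD FD delta0 Fsep phiI Fphi AN.
apply: le_trans (_ : (N * (Num.truncn D).+1 ^ 3)%:R <= _).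
  rewrite ler_nat; apply: leq_trans cN; apply/subset_leq_card/fintype.subsetP => j.
  rewrite finset.inE => jr; rewrite finset.inE; apply/asboolP.
  exact: (conj (Fphi j) (conj (FE _ (Fphi j)) jr)).
by rewrite natrM mulrC ler_wpM2l.
Qed.

(** Dividing by M J leaves N Cst >= M delta^(4 eps - s), and the lower bound on M costs a fifth eps.
    Since delta <= 1, the exponent with 7 eps gives a weaker bound. *)
Lemma final_arith {R : realType} {delta eps s s' M N J Cst : R} :
  0 < delta -> delta <= 1 -> 0 < eps -> 0 < M -> 0 < J -> 0 <= N -> 0 < Cst ->
  (delta `^ (- eps))^-1 * delta `^ (- s') <= M ->
  M ^+ 2 * J <= N * (Cst * delta `^ (- (2 * eps)) * (delta `^ (- eps) * M)
    * (delta `^ (- eps) * delta `^ s * J)) ->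
  Cst^-1 * delta `^ (7 * eps - s - s') <= N.
Proof.
move=> d0 d1 e0 M0 J0 N0 C0 ML H; rewrite ler_pdivrMl //.
have dn0 : delta != 0 by rewrite gt_eqF.
have pD x y : delta `^ (x + y) = delta `^ x * delta `^ y.
  by rewrite powRD ?dn0 ?implybT.
have p0 x : 0 < delta `^ x by exact: powR_gt0.
have pK x y : x + y = 0 -> delta `^ x * delta `^ y = 1.
  by move=> xy; rewrite -pD xy powRr0.
apply: le_trans (_ : delta `^ (5 * eps - s - s') <= _).
  apply: ger_powR; first by rewrite d0 d1.
  by lra.
have E1 : delta `^ (5 * eps - s - s') =
    delta `^ (4 * eps - s) * ((delta `^ (- eps))^-1 * delta `^ (- s')).
  by rewrite -powRN -!pD; congr (_ `^ _); ring.
rewrite E1; apply: le_trans (ler_wpM2l (ltW (p0 _)) ML) _.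
have MJ0 : 0 < M * J by rewrite mulr_gt0.
rewrite -(ler_pM2r MJ0).
have -> : delta `^ (4 * eps - s) * M * (M * J) = delta `^ (4 * eps - s) * (M ^+ 2 * J) by ring.
apply: le_trans (ler_wpM2l (ltW (p0 _)) H) _.
have -> : delta `^ (4 * eps - s) * (N * (Cst * delta `^ (- (2 * eps)) *
    (delta `^ (- eps) * M) * (delta `^ (- eps) * delta `^ s * J))) =
  Cst * N * (M * J) * (delta `^ (4 * eps - s) *
    (delta `^ (- (2 * eps)) * delta `^ (- eps) * delta `^ (- eps) * delta `^ s)) by ring.
by rewrite -!pD (_ : _ + _ = 0) ?powRr0 ?mulr1 //; ring.
Qed.

(* [delta0] depends only on epsilon and the implicit constant [c] only on n, K,
   D and an a priori C^2 bound L for the family: a ball of diameter K whose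
   centre is arbitrary gives no such bound, and without one no [c] exists. *)
Theorem theorem3p11 (R : realType) :
  exists delta0 : R -> R, (forall eps : R, 0 < eps -> 0 < delta0 eps) /\
  forall (n : nat) (K D L : R), (3 <= n)%N -> 0 < K ->
  exists c : R, 0 < c /\
  forall (s s' eps delta : R)
    (Omega : set (('rV[R]_(n - 2) -> 'rV[R]_(n - 1))
                  * 'rV[R]_((n - 2) + (n - 1)))),
    0 < s -> s <= s' -> s' <= (n - 2)%:R -> 0 < eps ->
    0 < delta < delta0 eps ->
    configuration K D delta s' s (delta `^ (- eps)) Omega ->
    (forall f, config_family Omega f -> C2norm (cube (n - 2)) f <= L) ->
    ((c * delta `^ (7 * eps - s - s'))%:E
       <= covering_number (@euclid_dist R _) setT delta (config_union Omega))%E.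
Proof.
(* The second entry is the threshold of [ln_inv_le_powR]. *)
exists (fun eps => Num.min 1 (eps `^ eps^-1)); split=> [eps e0|].
  by rewrite lt_min ltr01 powR_gt0.
move=> n K D L n3 K0.
have k0 : (0 < n - 2)%N by rewrite subn_gt0.
have l0 : (0 < n - 1)%N by rewrite subn_gt0 ltnW.
pose L1 := Num.max 0 L; have L10 : 0 <= L1 by rewrite le_max lexx.
pose a := (Num.truncn (2 * (1 + L1) * ((n - 2) + (n - 1))%N%:R)).+1.
have La : 2 * (1 + L1) * ((n - 2) + (n - 1))%N%:R <= a%:R.
  by rewrite ltW // real_truncnS_gt ?num_real.
have [CK CK0 CKP] := dyadic_scales K.
pose PC := pair_const (n - 2) (n - 1) a K L1.
have PC0 : 0 < PC.
  rewrite !mulr_gt0 ?ltr0n ?expn_gt0 ?ltr_wpDl // powR_gt0 //.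
  by rewrite ltr_wpDr // !mulr_ge0 ?(ltW K0) ?addr_ge0.
pose B3 : R := ((Num.truncn D).+1 ^ 3)%:R.
have B30 : 0 < B3 by rewrite ltr0n expn_gt0.
pose B' : R := ((2 * (2 * ((n - 2) + (n - 1)))).+1 ^ ((n - 2) + (n - 1)))%:R.
have B'0 : 0 < B' by rewrite ltr0n expn_gt0.
(* In order: cells per delta-ball, number of scales up to the power of delta, common cells of a
   pair, points of F per delta-ball. *)
pose Cst := B' * (CK * 2) * PC * B3.
have Cst0 : 0 < Cst.
  by apply: (mulr_gt0 (mulr_gt0 (mulr_gt0 B'0 _) PC0) B30); rewrite mulr_gt0.
exists Cst^-1; split; first by rewrite invr_gt0.
move=> s s' eps delta Omega s0 ss' s'k e0 /andP[d0]; rewrite lt_min => /andP[d1 de].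
set U := cube (n - 2); set F := config_family Omega.
move=> [_ [[f0 Ff0] Fsep Fds [_ [fc [fcC2 Fball]] Fdbl Fcin]] [M [M1 ML XP]]] FL.
set C := delta `^ (- eps) in Fds ML XP.
have C1 : 1 <= C.
  rewrite -[leLHS](powRr0 delta); apply: ger_powR; first by rewrite d0 ltW.
  by rewrite oppr_le0 ltW.
have C0 : 0 <= C := le_trans ler01 C1.
have s'0 : 0 < s' := lt_le_trans s0 ss'.
pose E : set ('rV[R]_(n - 2) -> 'rV[R]_(n - 1)) := C2maps U (cube (n - 1)).
have EC2 f : E f -> C2on U f by exact: C2on_C2maps.
have [FE _ _] := Fds.
have FC2 f (Ff : F f) : C2on U f := EC2 f (FE f Ff).
have dxx f (Ef : E f) : C2dist U f f = 0 := C2distxx (EC2 f Ef).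
have dC f g (Ef : E f) (Eg : E g) : C2dist U f g = C2dist U g f :=
  C2distC (EC2 f Ef) (EC2 g Eg).
have dD f g h (Ef : E f) (Eg : E g) (Eh : E h) :
    C2dist U f h <= C2dist U f g + C2dist U g h :=
  C2dist_triangle (EC2 f Ef) (EC2 h Eh) (EC2 g Eg).
(* The diameter bound caps the dyadic scales at K. *)
have diam f g : F f -> F g -> C2dist U f g <= K.
  move=> Ff Fg; have fcC := C2on_C2maps fcC2.
  have [_ cf] := Fball f Ff; have [_ cg] := Fball g Fg.
  apply: le_trans (C2dist_triangle (FC2 f Ff) (FC2 g Fg) fcC) _.
  have cf' : C2dist U f fc <= K / 2.
    exact: etrans (congr1 (fun z => z <= K / 2) (C2distC (FC2 f Ff) fcC)) cf.
  by rewrite [leRHS]splitr; exact: lerD cf' cg.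
have [J [phi [phiI phiP]]] := separated_enum FE dxx dC dD Fdbl d0 Fsep f0 K Ff0 K0
  (fun f Ff => diam f0 f Ff0 Ff).
have Fphi j : F (phi j) by apply/phiP; exists j.
have J0 : (0 < #|J|)%N.
  by have /phiP[j _] := Ff0; apply/card_gt0P; exists j.
have /choice[X {}XP] j := XP (phi j) (Fphi j).
have XU j : X j `<=` U by have [_ [] //] := XP j.
have GX j : graph_over (X j) (phi j) `<=` cube ((n - 2) + (n - 1)).
  by have [_ _ _ <- fc1] := XP j; exact: fc1.
have cin f g x xi : F f -> F g -> U x -> unit_sphere (n - 2) xi ->
    K^-1 * C2norm U (f \- g)
    <= euclid_norm (f x - g x) + euclid_norm ('D_xi f x - 'D_xi g x).
  move=> Ff Fg Ux xi1; apply: le_trans (Fcin f g Ff Fg) _.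
  apply: ge_inf; last by exists x => //; exists xi.
  exists 0 => _ [y _ [zeta _ <-]].
  by apply: addr_ge0; exact: euclid_norm_ge0.
have phiL j : C2norm U (phi j) <= L1.
  by rewrite le_max (FL _ (Fphi j)) orbT.
pose Q j : {set grid _ (delta / ((n - 2) + (n - 1))%N%:R)} :=
  cells (graph_over (X j) (phi j)).
have MQ j : M <= #|Q j|%:R.
  have [_ _ XM _ _] := XP j; rewrite -lee_fin -XM.
  exact: covering_number_le (covering_le_cells k0 d0 (XU j) (GX j)).
have M0 : 0 < M := lt_le_trans ltr01 M1.
have [|I KI IC] := CKP delta; first by rewrite d0 ltW.
pose P1 := B3 * (C * delta `^ s * #|J|%:R).
have P10 : 0 <= P1 by rewrite mulr_ge0 ?(ltW B30) // !mulr_ge0 ?powR_ge0.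
have PCM0 : 0 <= PC * C * M := mulr_ge0 (mulr_ge0 (ltW PC0) C0) (ltW M0).
have QP j : \sum_j' #|Q j :&: Q j'|%:R <= I.+1%:R * (PC * C * M * P1).
  apply: (dyadic_sum (fun j' => C2dist U (phi j) (phi j')) _ delta s s') => //.
  - by move=> j'; exact: le_trans (diam _ _ (Fphi j) (Fphi j')) KI.
  - move=> j' i _ di; have [_ Xds XM _ _] := XP j.
    have cinj x xi := cin (phi j) (phi j') x xi (Fphi j) (Fphi j').
    apply: (pair_bound i k0 l0 K0 d0 _ C1 (FC2 _ (Fphi j)) (FC2 _ (Fphi j'))
      (phiL j) (phiL j') La Xds XM (XU j') (GX j) (GX j') cinj _ di).
      by rewrite s'0.
    exact: diam (Fphi j) (Fphi j').
  move=> i.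
  have p1 : 1 <= 2 ^+ i :> R by rewrite exprn_ege1 // ler1n.
  have p0 : 0 <= 2 ^+ i :> R := le_trans ler01 p1.
  have := neighbor_count (phi j) (2 ^+ i * delta) dxx dC dD Fdbl d0 Fsep Fds C0
    phiI phiP (FE _ (Fphi j)).
  rewrite ler_peMl // ?(ltW d0) // => /(_ isT) H.
  apply: le_trans H _; rewrite powRM // ?(ltW d0) //.
  by rewrite /P1 -/B3 le_eqVlt; apply/orP; left; apply/eqP; ring.
have DC := double_counting Q M _ (ltW M0) MQ QP J0.
(* It suffices to bound the size N of an arbitrary finite cover from below. *)
apply/ereal_infP => _ [N EN <-]; rewrite lee_fin.
have QN : #|(\bigcup_j Q j)%SET|%:R <= N%:R * B'.
  rewrite -natrM ler_nat.
  apply: leq_trans (card_cells_covering _ N _ d0 _ EN).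
  - apply/subset_leq_card/fintype.subsetP => q /finset.bigcupP[j _].
    rewrite /Q finset.inE => /asboolP[p jp pq]; rewrite finset.inE; apply/asboolP.
    have jp' : fiber Omega (phi j) p by have [_ _ _ -> _] := XP j.
    exact: (ex_intro2 _ _ p (ex_intro2 _ _ (phi j) (Fphi j) jp') pq).
  - by rewrite addn_gt0 k0.
  move=> p [f Ff fp]; have /phiP[j jf] := Ff.
  by apply: (GX j); have [_ _ _ <- _] := XP j; rewrite jf.
have I2 : I.+1%:R <= CK * 2 * delta `^ (- (2 * eps)).
  apply: le_trans IC _; rewrite -mulrA ler_pM2l // mulr_natl mulr2n; apply: lerD.
    rewrite -[leLHS](powRr0 delta); apply: ger_powR; first by rewrite d0 ltW.
    by rewrite oppr_le0 mulr_ge0 // ltW.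
  exact: ln_inv_le_powR e0 d0 (ltW de).
have J0R : 0 < #|J|%:R :> R by rewrite ltr0n.
apply: (final_arith d0 (ltW d1) e0 M0 J0R _ Cst0 ML) => //.
apply: le_trans DC _.
apply: le_trans (_ : N%:R * B' * (CK * 2 * delta `^ (- (2 * eps)) * (PC * C * M * P1)) <= _).
  have PP : 0 <= PC * C * M * P1 := mulr_ge0 PCM0 P10.
  by apply: ler_pM => //; [exact: mulr_ge0|exact: ler_wpM2r].
by rewrite le_eqVlt; apply/orP; left; apply/eqP; rewrite /P1 /Cst -/C; ring.
Qed.
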